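(* Let $M$ and $N$ be two finite median graphs. Then the crossing graphs $\mathrm{Cross}(M)$ and $\mathrm{Cross}(N)$ are isomorphic if and only if (up to graph-isomorphism) $N$ can be obtained from $M$ by a finite sequence of slidings.
   Context: Graphs are simple and undirected. A connected graph $M$ with graph metric $d$ is median if for all vertices $x_1,x_2,x_3$ there is a unique vertex $m$ with $d(x_i,x_j)=d(x_i,m)+d(m,x_j)$ for all $i\neq j$. $\Theta$-classes: two edges $\{a,b\},\{x,y\}$ of a connected graph are in $\Theta$-relation if $d(a,x)+d(b,y)\neq d(a,y)+d(b,x)$. In a median graph $\Theta$ is an equivalence relation on edges, and it coincides with the reflexive-transitive closure of the relation ''being opposite edges of a square'', where a square is an induced 4-cycle. Two distinct $\Theta$-classes cross if they contain two edges sharing an endpoint and spanning a square (i.e. both are edges of a common square). The crossing graph $\mathrm{Cross}(M)$ has as vertices the $\Theta$-classes of $M$, two $\Theta$-classes being adjacent when they cross. A subgraph is convex if it is non-empty and contains all the geodesics between its vertices. A $\Theta$-class crosses a convex subgraph if the subgraph contains an edge of this class. Two convex subgraphs $Y,Z$ of a median graph $M$ are parallel if they are crossed by exactly the same $\Theta$-classes of $M$. The gate-projection of a vertex $x$ to a convex subgraph $Y$ of a median graph is the unique vertex $p\in V(Y)$ with $d(x,y)=d(x,p)+d(p,y)$ for all $y\in V(Y)$. If $Y,Z$ are parallel, the gate-projection to $Y$ induces a graph-isomorphism $Z\to Y$. Amalgams: for graphs $A,B$, subgraphs $C_1\leq A$, $C_2\leq B$ and a graph-isomorphism $\varphi:C_1\to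 C_2$, $A\ast_{C_1=_\varphi C_2}B$ is the quotient of $A\sqcup B$ identifying each vertex and edge of $C_1$ with its image under $\varphi$. Amalgamating two median graphs along isomorphic convex subgraphs yields a median graph. Sliding: let $M_1,M_2$ be median graphs, $Y_1\leq M_1$, $Y_2\leq M_2$ convex subgraphs, $\varphi:Y_1\to Y_2$ a graph-isomorphism, $Y_1'\leq M_1$ a convex subgraph parallel to $Y_1$ in $M_1$, and $\pi:Y_1'\to Y_1$ the gate-projection. Then the median graph $M_1\ast_{Y_1'=_{\varphi\circ\pi}Y_2}M_2$ is said to be obtained from $M_1\ast_{Y_1=_\varphi Y_2}M_2$ by a sliding. *)

(* Defs.v *)
From mathcomp Require Import all_boot.

Set Implicit Arguments.
Unset Strict Implicit.
Unset Printing Implicit Defensive.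

Record sgraph := SGraph {
  vertex :> finType;
  adj : rel vertex;
  adj_sym : symmetric adj;
  adj_irrefl : irreflexive adj
}.

Definition graph_iso (G H : sgraph) (f : G -> H) : Prop :=
  bijective f /\ {mono f : x y / adj x y}.

Definition isomorphic (G H : sgraph) : Prop := exists f : G -> H, graph_iso f.

Section Metric.
Variable G : sgraph.
Implicit Types (x y z a b c d m : G) (Y Z : {set G}).

(* The empty graph is not connected. *)
Definition connected : Prop :=
  0 < #|G| /\ forall x y, connect (@adj G) x y.

Definition walk (n : nat) : rel G :=
  fun x y => [exists p : n.-tuple G, path (@adj G) x p && (last x p == y)].

(* The least length of a walk from x to y; it is < #|G| as soon as such a walk
   exists, and the junk value #|G| is returned otherwise. *)
Definition dist x y : nat := find (fun n => walk n x y) (iota 0 #|G|).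

Definition median : Prop :=
  connected /\
  forall x1 x2 x3, exists! m,
    [/\ dist x1 x2 = dist x1 m + dist m x2,
        dist x1 x3 = dist x1 m + dist m x3
      & dist x2 x3 = dist x2 m + dist m x3].

(* An undirected edge is the unordered pair of its endpoints. *)
Definition edges : {set {set G}} :=
  [set [set u.1; u.2] | u : G * G & adj u.1 u.2].

(* The inequality is invariant under swapping a with b or x with y, up to
   swapping its two sides, so the choice of labellings is irrelevant. *)
Definition theta : rel {set G} := fun E F =>
  [exists a, exists b, exists x, exists y,
    [&& E == [set a; b], F == [set x; y]
      & dist a x + dist b y != dist a y + dist b x]].

(* These are the equivalence classes of theta when theta is an equivalence
   relation on the edges, as it is in a median graph. *)
Definition theta_classes : {set {set {set G}}} :=
  equivalence_partition theta edges.

(* a, b, c, d, in this cyclic order, span an induced 4-cycle. *)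
Definition square a b c d : bool :=
  [&& adj a b, adj b c, adj c d, adj d a,
      a != c, b != d, ~~ adj a c & ~~ adj b d].

Definition cross (C D : {set {set G}}) : bool :=
  (C != D) &&
  [exists a, exists b, exists c, exists d,
    [&& square a b c d, [set a; b] \in C & [set a; d] \in D]].

Lemma cross_sym : symmetric cross.
Proof.
suff sub C D : cross C D -> cross D C by move=> C D; apply/idP/idP; apply: sub.
case/andP=> neqCD /existsP[a /existsP[b /existsP[c /existsP[d]]]].
case/and3P=> /and5P[ab bc cd da /and4P[ac bd nac nbd]] abC adD.
rewrite /cross eq_sym neqCD /=.
apply/existsP; exists a; apply/existsP; exists d.
apply/existsP; exists c; apply/existsP; exists b.
rewrite /square adD abC !andbT (adj_sym a d) da (adj_sym d c) cd.
by rewrite (adj_sym c b) bc (adj_sym b a) ab ac eq_sym bd nac (adj_sym d b).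
Qed.

Lemma cross_irrefl : irreflexive cross.
Proof. by move=> C; rewrite /cross eqxx. Qed.

Definition geodesic x (p : seq G) : bool :=
  path (@adj G) x p && (size p == dist x (last x p)).

(* An edge is a geodesic, so a convex subgraph is induced and can be encoded
   by its set of vertices. *)
Definition convex Y : Prop :=
  Y != set0 /\
  forall x (p : seq G),
    x \in Y -> last x p \in Y -> geodesic x p -> {subset p <= Y}.

Definition class_crosses (C : {set {set G}}) Y : bool :=
  [exists E in C, E \subset Y].

Definition parallel Y Z : Prop :=
  forall C, C \in theta_classes -> class_crosses C Y = class_crosses C Z.

(* The default value is never used when G is median and Y is convex. *)
Definition gate Y x : G :=
  odflt x [pick p in Y | [forall y in Y, dist x y == dist x p + dist p y]].

End Metric.

Definition Cross (G : sgraph) : sgraph :=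
  @SGraph {C : {set {set G}} | C \in theta_classes G}
    (fun C D => cross (val C) (val D))
    (fun C D => cross_sym (val C) (val D))
    (fun C => cross_irrefl (val C)).

(* f restricts to an isomorphism between the subgraphs induced by C1 and C2;
   its values outside C1 are irrelevant. *)
Definition iso_on (A B : sgraph) (C1 : {set A}) (C2 : {set B}) (f : A -> B) :
    Prop :=
  [/\ {in C1 &, injective f}, f @: C1 = C2
    & {in C1 &, {mono f : x y / adj x y}}].

Section Amalgam.
Variables (A B : sgraph) (C1 : {set A}) (f : A -> B).

Definition sum_adj (u v : A + B) : bool :=
  match u, v with
  | inl a, inl a' => adj a a'
  | inr b, inr b' => adj b b'
  | _, _ => false
  end.

Definition glue (u v : A + B) : bool :=
  match u, v with
  | inl a, inr b => (a \in C1) && (b == f a)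
  | _, _ => false
  end.

(* The equivalence relation generated by glue. *)
Definition glue_eq : rel (A + B)%type :=
  connect (fun u v => glue u v || glue v u).

(* Quotient points are equivalence classes in the disjoint union of A and B. *)
Definition amalgam_vertex : finType :=
  {p : {set A + B} | p \in equivalence_partition glue_eq setT}.

(* When f is an isomorphism from C1 onto an induced subgraph of B, adjacent
   vertices of the disjoint union are never identified, and the first conjunct
   is redundant: it only makes the relation irreflexive for arbitrary f. *)
Definition amalgam_adj (p q : amalgam_vertex) : bool :=
  (p != q) && [exists u in val p, exists v in val q, sum_adj u v].

Lemma amalgam_adj_sym : symmetric amalgam_adj.
Proof.
suff sub p q : amalgam_adj p q -> amalgam_adj q p.
  by move=> p q; apply/idP/idP; apply: sub.
case/andP=> neqpq /exists_inP[u up /exists_inP[v vq uv]].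
rewrite /amalgam_adj eq_sym neqpq /=; apply/exists_inP; exists v => //.
apply/exists_inP; exists u => //.
by case: u v uv {up vq} => [a|b] [a'|b'] //=; rewrite adj_sym.
Qed.

Lemma amalgam_adj_irrefl : irreflexive amalgam_adj.
Proof. by move=> p; rewrite /amalgam_adj eqxx. Qed.

Definition amalgam : sgraph := SGraph amalgam_adj_sym amalgam_adj_irrefl.

End Amalgam.

(* Up to isomorphism, N is obtained from M by one sliding. *)
Definition sliding (M N : sgraph) : Prop :=
  exists (M1 M2 : sgraph) (Y1 Y1' : {set M1}) (Y2 : {set M2}) (phi : M1 -> M2),
    [/\ median M1 /\ median M2,
        [/\ convex Y1, convex Y2 & convex Y1'],
        iso_on Y1 Y2 phi,
        parallel Y1 Y1'
      & isomorphic M (amalgam Y1 phi) /\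
        isomorphic N (amalgam Y1' (phi \o gate Y1))].

Inductive slidings (M : sgraph) : sgraph -> Prop :=
| Slidings0 N of isomorphic M N : slidings M N
| SlidingsS P N of slidings M P & sliding P N : slidings M N.

(* Main.v *)
Require Import Defs.
From mathcomp Require Import all_boot zify.

(** Crossing graphs only see squares and Theta-classes, and a sliding changes
    neither: each square of an amalgam of median graphs along convex subgraphs
    lies in one of the two pieces, and an edge of one piece is related to an edge
    of the other exactly when both are related to an edge of the overlap. Moving
    the overlap to a parallel copy replaces its edges by edges of the same
    classes ([slides_Cross_iso], [sliding_Cross]).

    Conversely, a median graph M is slid to a normal form that depends on its
    crossing graph only. Fix a vertex o. An edge ob cuts M into the halfspaces
    of o and of b, and M is the amalgam, along the boundary of b's halfspace, of
    that halfspace with everything else enlarged by this boundary. The boundary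
    of o's halfspace is a parallel copy, and o lies on it; sliding b's halfspace
    there brings each of its vertices outside the boundary one step closer to o
    and moves no other vertex ([fold]). So the sum of the distances to o
    decreases until each halfspace opposite o across an edge at o coincides with
    its own boundary ([slide_to_folded]).

    In such a folded graph each class has exactly one edge at o. Send a vertex x
    to the set of classes separating it from o. These classes pairwise cross,
    because two neighbours of o closer to x span a square with the median of x
    and themselves; conversely a clique of classes is realised by crossing its
    walls one after the other ([folded_extend]). Hence a folded graph is the
    simplex graph of its crossing graph ([folded_simplex]), and two median
    graphs with isomorphic crossing graphs slide to the same normal form. Since
    projecting between parallel subgraphs is invertible, slidings can be undone
    ([sliding_sym]), which connects M to N.

    The metric input is that halfspaces of median graphs are convex
    ([side_convex]), which follows from the isometry between the two ends of the
    edges crossing a wall ([matching_isometric]). *)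

Set Implicit Arguments.
Unset Strict Implicit.
Unset Printing Implicit Defensive.


(** * The graph metric *)

Section GraphMetric.
Variable G : sgraph.
Hypothesis conn : connected G.
Implicit Types (x y z : G) (p : seq G) (Y : {set G}).

Lemma walkP n x y :
  reflect (exists p, [/\ size p = n, path (@adj G) x p & last x p = y])
          (walk n x y).
Proof.
apply: (iffP existsP) => [[p /andP[px /eqP ly]]|[p [sp px ly]]].
  by exists p; rewrite size_tuple.
move/eqP in sp; exists (Tuple sp); rewrite /= px; exact/eqP.
Qed.

Lemma dist_le_walk n x y : walk n x y -> dist x y <= n.
Proof.
move=> w; rewrite leqNgt; apply/negP => lt_n.
have := before_find 0 lt_n; rewrite nth_iota ?add0n ?w //.
by apply: leq_trans lt_n _; rewrite /dist -[X in _ <= X](size_iota 0) find_size.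
Qed.

Lemma dist_walk x y : walk (dist x y) x y.
Proof.
have [p px -> {y}] := connectP (conn.2 x y).
have [q qx uq _] := shortenP px; set y := last x q.
have lt_q : size q < #|G| by have := max_card (mem (x :: q)); rewrite (card_uniqP uq).
have w : has (fun n => walk n x y) (iota 0 #|G|).
  apply/hasP; exists (size q); first by rewrite mem_iota add0n.
  by apply/walkP; exists q.
have := nth_find 0 w; rewrite nth_iota ?add0n //.
by rewrite -[X in _ < X](size_iota 0) -has_find.
Qed.

Lemma distxx x : dist x x = 0.
Proof. by apply/eqP; rewrite -leqn0 dist_le_walk //; apply/walkP; exists [::]. Qed.

Lemma dist_eq0 x y : dist x y = 0 -> x = y.
Proof. by move=> xy0; have := dist_walk x y; rewrite xy0 => /walkP[[|a p] [//= _ _ <-]]. Qed.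

Lemma dist_sym x y : dist x y = dist y x.
Proof.
suff le (u v : G) : dist u v <= dist v u by apply/eqP; rewrite eqn_leq !le.
have /walkP[p [<- vp <-]] := dist_walk v u.
apply: dist_le_walk; apply/walkP; exists (rev (belast v p)).
rewrite size_rev size_belast rev_path; split=> //; first last.
  by case: p {vp} => //= a p; rewrite rev_cons last_rcons.
by rewrite (eq_path (e' := @adj G)) // => a b; rewrite adj_sym.
Qed.

Lemma dist_triangle y x z : dist x z <= dist x y + dist y z.
Proof.
have /walkP[p [<- xp ly]] := dist_walk x y; have /walkP[q [<- yq <-]] := dist_walk y z.
apply: dist_le_walk; apply/walkP; exists (p ++ q).
by rewrite size_cat cat_path last_cat ly xp yq.
Qed.

Lemma adj_dist1 x y : adj x y <-> dist x y = 1.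
Proof.
split=> [xy | d1].
  have le1 : dist x y <= 1.
    by apply: dist_le_walk; apply/walkP; exists [:: y]; rewrite /= xy.
  case E: (dist x y) le1 => [|[|]] // _.
  by move: xy; rewrite (dist_eq0 E) adj_irrefl.
have := dist_walk x y; rewrite d1 => /walkP[[|a [|b p]] [] //= _].
by rewrite andbT => xa <-.
Qed.

Lemma dist_step n x y : dist x y = n.+1 -> exists2 z, adj x z & dist z y = n.
Proof.
move=> dn; have := dist_walk x y; rewrite dn => /walkP[[|z p] [] //= sp xp lp].
case/andP: xp => xz zp; exists z => //.
have : dist z y <= n by apply: dist_le_walk; apply/walkP; exists p; case: sp.
by have := dist_triangle z x y; rewrite dn ((adj_dist1 x z).1 xz); lia.
Qed.

(** Read F along a geodesic. This bounds distances from below in graphs, such as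
    amalgams, whose geodesics have no direct description. *)
Lemma lipschitz_le_dist (F : G -> nat) x y :
  F x = 0 -> (forall u v, adj u v -> F v <= F u + 1) -> F y <= dist x y.
Proof.
move=> Fx lip; have /walkP[p [<- xp <-]] := dist_walk x y.
rewrite -[X in _ <= X]add0n -Fx; elim: p x xp {Fx} => [|z p IH] x /=.
  by rewrite addn0.
by case/andP=> /lip le_xz /IH; lia.
Qed.

Definition between x z y := dist x y == dist x z + dist z y.

Lemma betweenP x z y : reflect (dist x y = dist x z + dist z y) (between x z y).
Proof. exact: eqP. Qed.

Lemma between_convexP Y :
  convex Y <->
  Y != set0 /\ forall x y z, x \in Y -> y \in Y -> between x z y -> z \in Y.
Proof.
split=> -[Y0 cY]; split=> // x.
  move=> y z xY yY /betweenP xzy.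
  have /walkP[p [sp xp lp]] := dist_walk x z; have /walkP[q [sq zq lq]] := dist_walk z y.
  have := cY x (p ++ q) xY; rewrite last_cat lp lq => /(_ yY).
  rewrite /geodesic cat_path lp xp zq last_cat lp lq size_cat xzy sp sq eqxx.
  move=> /(_ isT) sub; case: p lp sub {sp xp} => [|a p] /= lp sub; first by rewrite -lp.
  by apply: sub; rewrite -lp -[_ :: _]/((a :: p) ++ q) mem_cat mem_last.
move=> p xY lY /andP[xp /eqP sp] z /splitPr def_p.
case: def_p xp sp lY => p1 p2; rewrite -cat_rcons cat_path last_cat last_rcons size_cat.
case/andP=> xp zp sp lY; apply: cY xY lY _; apply/betweenP.
apply/eqP; rewrite eqn_leq dist_triangle -sp leq_add //; apply: dist_le_walk; apply/walkP.
  by exists (rcons p1 z); rewrite last_rcons.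
by exists p2.
Qed.

End GraphMetric.


(** * Halfspaces of a median graph *)

(** The halfspace of a cut out by the edge ab, as a predicate. *)
Definition side (G : sgraph) (a b x : G) := dist x a < dist x b.

(** Theta read on oriented edges. *)
Definition th (G : sgraph) (a b x y : G) :=
  dist a x + dist b y != dist a y + dist b x.

Section Halfspaces.
Variable G : sgraph.
Hypothesis medG : median G.
Implicit Types a b m n u v w x y z : G.

Let conn : connected G := medG.1.
Let symd := dist_sym conn.
Let tri := dist_triangle conn.
Let adj1 := adj_dist1 conn.

Lemma medianE x y z :
  exists m, [/\ dist x y = dist x m + dist m y, dist x z = dist x m + dist m z
              & dist y z = dist y m + dist m z].
Proof. by have [m [mP _]] := medG.2 x y z; exists m. Qed.

Lemma median_uniq x y z m n :
  [/\ dist x y = dist x m + dist m y, dist x z = dist x m + dist m z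
    & dist y z = dist y m + dist m z] ->
  [/\ dist x y = dist x n + dist n y, dist x z = dist x n + dist n z
    & dist y z = dist y n + dist n z] -> m = n.
Proof. by have [k [_ kP]] := medG.2 x y z; move=> /kP <- /kP <-. Qed.

(** The median of a, b and x is a or b. *)
Lemma median_bipartite x a b : adj a b -> dist x a != dist x b.
Proof.
move/adj1=> ab; apply/eqP=> eq_d; have [m [E1 E2 E3]] := medianE a b x.
have := symd x a; have := symd x b; have := symd m b.
case E: (dist a m) => [|k]; first by have := dist_eq0 conn E => ?; subst m; lia.
by case E': (dist m b) => [|?]; [have := dist_eq0 conn E' => ?; subst m|]; lia.
Qed.

Lemma side_dist a b x : adj a b -> side a b x -> dist x b = dist x a + 1.
Proof. by rewrite /side => /adj1; have := tri a x b; lia. Qed.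

Lemma sideC a b x : adj a b -> side b a x = ~~ side a b x.
Proof. by rewrite /side => /(median_bipartite x); lia. Qed.

Lemma side_l a b : adj a b -> side a b a.
Proof. by rewrite /side => /adj1 ->; rewrite distxx. Qed.

Lemma side_r a b : side a b b = false.
Proof. by rewrite /side distxx. Qed.

(** The triangle inequality across xy bounds each side by the other. *)
Lemma matching_dist a b x y :
  adj a b -> adj x y -> side a b x -> side b a y -> dist x a = dist y b.
Proof.
move=> ab /adj1 xy /(side_dist ab); rewrite adj_sym in ab => + /(side_dist ab).
by have := tri x y a; have := tri y x b; have := symd x y; lia.
Qed.

(** Otherwise n and the median of y, y' and b would be two medians of y, y' and
    a. *)
Lemma matching_uniq a b n y y' :
  adj a b -> adj n y -> adj n y' -> side a b n -> side b a y -> side b a y' ->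
  y = y'.
Proof.
move=> ab ny ny' an bny bny'.
have ba : adj b a by rewrite adj_sym.
have E := matching_dist ab ny an bny; have E' := matching_dist ab ny' an bny'.
have D := side_dist ba bny; have D' := side_dist ba bny'; have Dn := side_dist ab an.
have [z [z1 z2 z3]] := medianE y y' b.
have dyy' : dist y y' != 1 by apply/eqP=> /adj1 /(median_bipartite n); rewrite (adj1 _ _).1 ?(adj1 _ _).1.
move: ny ny' ba => /adj1 ny /adj1 ny' /adj1 ba.
have := tri n y y'; rewrite (symd y n) ny ny' => le2.
case yy': (dist y y') dyy' le2 => [|[|[|?]]] // _ _; first exact: dist_eq0 yy'.
have nz : n = z.
  have := symd y' z; have := tri z y a; have := tri b z a; have := symd y n; have := symd y' n.
  by move=> *; apply: (@median_uniq y y' a); split; lia.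
by subst z; move: D D' Dn z1 z2 z3; lia.
Qed.

(** If x1 is the next vertex on the way to n, the median of x1, y and b completes
    a square over the edges x x1 and xy; squares thus carry the crossing edge
    along the geodesic. *)
Lemma ladder a b x y n :
  adj a b -> adj x y -> side a b x -> side b a y -> between x n a ->
  exists n', [/\ adj n n', side b a n' & dist y n' <= dist x n].
Proof.
move=> ab; have ba : adj b a by rewrite adj_sym.
move E: (dist x n) => k; elim: k x y E => [|k IH] x y E xy ax bny /betweenP xna.
  by exists y; rewrite -(dist_eq0 conn E) distxx.
have [x1 xx1 x1n] := dist_step conn E.
have Dx := side_dist ab ax; have Dy := side_dist ba bny.
have M := matching_dist ab xy ax bny.
move/adj1 in xx1; have T1 := tri x1 x a; have T2 := tri n x1 a; have T3 := tri x1 x b.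
have T4 := tri a x1 b; move/adj1: (ab) => ab1.
have ax1 : side a b x1 by rewrite /side; lia.
have [y1 [y11 y12 y13]] := medianE x1 y b.
have := tri x x1 y; rewrite (symd x1 x) xx1 ((adj1 x y).1 xy) => le2.
have d0 : dist x1 y != 0.
  apply/eqP=> /(dist_eq0 conn) eq1; move: bny; rewrite -eq1 sideC //.
  by rewrite ax1.
have d1 : dist x1 y != 1.
  by apply/eqP=> /adj1 /(matching_dist ab) /(_ ax1 bny); lia.
have sy1 := symd y y1.
have T5 := tri y1 y a; have T6 := tri b y1 a; move/adj1: (ba) => ba1.
have [||||n' [nn' bn' le_n']] := IH x1 y1 x1n.
- by apply/adj1; lia.
- by [].
- by rewrite /side; lia.
- by apply/betweenP; lia.
by exists n'; split=> //; move: (tri y1 y n') sy1 y11 y12 y13 le_n' le2 d0 d1 M T1 T2 T3 T4 ab1 xx1 xna x1n E Dx Dy; clear; lia.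
Qed.

(** The ladders from xy and x'y' to the median of x, x' and a end in the same
    crossing edge. *)
Lemma matching_dist_le a b x y x' y' :
  adj a b -> adj x y -> adj x' y' -> side a b x -> side b a y ->
  side a b x' -> side b a y' -> dist y y' <= dist x x'.
Proof.
move=> ab xy xy' ax ay ax' ay'; have [n [E1 E2 E3]] := medianE x x' a.
have [|p [np bp le_p]] := @ladder a b x y n ab xy ax ay; first exact/betweenP.
have [|q [nq bq le_q]] := @ladder a b x' y' n ab xy' ax' ay'; first exact/betweenP.
have an : side a b n.
  by rewrite /side; move: (side_dist ab ax) (tri n x b) E2; clear; lia.
have pq := matching_uniq ab np nq an bp bq; subst q.
by move: le_p le_q E1 (tri p y y') (symd p y') (symd n x'); clear; lia.
Qed.

Lemma matching_isometric a b x y x' y' :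
  adj a b -> adj x y -> adj x' y' -> side a b x -> side b a y ->
  side a b x' -> side b a y' -> dist y y' = dist x x'.
Proof.
move=> ab xy xy' ax ay ax' ay'; apply/eqP; rewrite eqn_leq.
rewrite (@matching_dist_le a b) //; apply: (@matching_dist_le b a) => //.
all: by rewrite adj_sym.
Qed.

Lemma geodesic_crossing a b u w :
  adj a b -> side a b u -> side b a w ->
  exists p q, [/\ adj p q, side a b p, side b a q
                & dist u w = dist u p + 1 + dist q w].
Proof.
move=> ab; move E: (dist u w) => k; elim: k u E => [|k IH] u E au bw.
  by move: bw; rewrite -(dist_eq0 conn E) sideC // au.
have [u1 uu1 u1w] := dist_step conn E.
case au1: (side a b u1); last first.
  by exists u, u1; rewrite (@sideC a b) // au1 u1w distxx; split=> //; lia.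
have [p [q [pq ap bq E']]] := IH _ u1w au1 bw; exists p, q; split=> //.
move/adj1 in uu1; move/adj1: (pq); have := tri u1 u p; have := tri p u w; have := tri q p w; lia.
Qed.

(** Leaving a halfspace and coming back costs two more edges than travelling
    inside, because crossing edges are matched isometrically. *)
Lemma side_convex a b u v w :
  adj a b -> side a b u -> side a b v -> between u w v -> side a b w.
Proof.
move=> ab au av /betweenP uwv; apply/negPn; rewrite -sideC //; apply/negP => bw.
have [p [q [pq ap bq E]]] := geodesic_crossing ab au bw.
have [s [r [sr as_ br E']]] := geodesic_crossing ab av bw.
have := matching_isometric ab pq sr ap bq as_ br.
have := symd v w; have := symd v s; have := symd r w.
move: (tri p u v) (tri s p v) (tri w q r) uwv E E'; clear; lia.
Qed.

(** If z were on the side of a but on that of y, then y would lie on a geodesic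
    from z to x, against convexity. *)
Lemma side_eq a b x y :
  adj a b -> adj x y -> side a b x -> side b a y -> side a b =1 side x y.
Proof.
have incl (p q s t : G) : adj p q -> adj s t -> side p q s -> side q p t ->
    forall z, side p q z -> side s t z.
  move=> pq st ps qt z pz; apply/negPn; rewrite -sideC //; apply/negP => tz.
  have : side p q t.
    apply: side_convex pq ps pz _; apply/betweenP.
    rewrite adj_sym in st; have := side_dist st tz; move/adj1: st.
    by have := symd s z; have := symd t z; have := symd s t; lia.
  by move: qt; rewrite sideC // => /negP.
move=> ab xy ax ay z; have ba : adj b a by rewrite adj_sym.
have yx : adj y x by rewrite adj_sym.
apply/idP/idP => [|xz]; first exact: incl.
apply/negPn; rewrite -sideC //; apply/negP => /(incl _ _ _ _ ba yx ay ax).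
by rewrite sideC // xz.
Qed.

(** * The relation Theta *)

Lemma th_side a b x y :
  adj a b -> adj x y -> th a b x y = (side a b x != side a b y).
Proof.
rewrite /th /side => ab /adj1 xy.
have := median_bipartite x ab; have := median_bipartite y ab.
move/adj1: ab; have := tri a x b; have := tri b x a; have := tri a y b; have := tri b y a.
have := symd a b; have := symd x y; have := tri x y a; have := tri y x a.
rewrite (symd a x) (symd b y) (symd a y) (symd b x).
have := tri x y b; have := tri y x b; lia.
Qed.

Lemma th_same_side a b x y :
  adj a b -> adj x y -> th a b x y ->
  side a b =1 side x y \/ side a b =1 side y x.
Proof.
move=> ab xy; rewrite th_side //; case ax: (side a b x); case ay: (side a b y) => // _.
  by left; apply: side_eq; rewrite // sideC // ay.
by right; apply: side_eq; rewrite // 1?adj_sym // sideC // ax.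
Qed.

Lemma th_refl a b : adj a b -> th a b a b.
Proof. by move=> ab; rewrite th_side // side_l // side_r. Qed.

Lemma th_sym a b x y : th a b x y = th x y a b.
Proof. by rewrite /th (symd a x) (symd b y) (symd a y) (symd b x) [dist y a + _]addnC. Qed.

Lemma th_swapr a b x y : th a b y x = th a b x y.
Proof. by rewrite /th eq_sym. Qed.

Lemma th_swapl a b x y : th b a x y = th a b x y.
Proof. by rewrite /th eq_sym addnC [dist b x + _]addnC. Qed.

Lemma th_trans a b x y u v :
  adj a b -> adj x y -> adj u v -> th a b x y -> th x y u v -> th a b u v.
Proof.
move=> ab xy uv T; have yx : adj y x by rewrite adj_sym.
rewrite !th_side //; case: (th_same_side ab xy T) => E; rewrite !E // ![side y x _]sideC //.
by case: (side x y u); case: (side x y v).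
Qed.

Lemma theta_set2 a b x y : theta [set a; b] [set x; y] = th a b x y.
Proof.
apply/idP/idP; last first.
  move=> T; apply/existsP; exists a; apply/existsP; exists b.
  by apply/existsP; exists x; apply/existsP; exists y; rewrite !eqxx.
case/existsP=> a' /existsP[b' /existsP[x' /existsP[y' /and3P[/eqP E1 /eqP E2 T]]]].
have set2 (p q p' q' : G) : [set p; q] = [set p'; q'] ->
    (p = p' /\ q = q') \/ (p = q' /\ q = p').
  move=> E; have := set21 p q; have := set22 p q; rewrite E.
  have := set21 p' q'; have := set22 p' q'; rewrite -{1 2}E !inE.
  by move=> /orP[]/eqP A /orP[]/eqP B /orP[]/eqP C /orP[]/eqP D; subst; auto.
rewrite -/(th a' b' x' y') in T.
by case: (set2 _ _ _ _ E1) (set2 _ _ _ _ E2) => [[-> ->]|[-> ->]] [[-> ->]|[-> ->]];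
  rewrite // ?[th b' a' _ _]th_swapl ?[th _ _ y' x']th_swapr.
Qed.

Lemma edgesP (E : {set G}) :
  reflect (exists a b, adj a b /\ E = [set a; b]) (E \in edges G).
Proof.
apply: (iffP imsetP) => [[[a b]]|[a [b [ab ->]]]].
  by rewrite inE => /= ab ->; exists a, b.
by exists (a, b); rewrite ?inE.
Qed.

End Halfspaces.


(** * Gates and parallel convex subgraphs *)

Section Gates.
Variable G : sgraph.
Hypothesis medG : median G.
Implicit Types (a b p q x y z : G) (Y Z : {set G}).

Let conn : connected G := medG.1.
Let symd := dist_sym conn.
Let tri := dist_triangle conn.
Let adj1 := adj_dist1 conn.

(** A vertex of Y nearest to x is its gate: the median of x, the nearest vertex
    and any y in Y lies in Y by convexity, hence is the nearest vertex itself. *)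
Lemma gateP Y x :
  convex Y -> gate Y x \in Y /\ {in Y, forall y, between x (gate Y x) y}.
Proof.
move=> /(between_convexP conn)[/set0Pn[y0 y0Y] cY].
have [p pY min_p] := @arg_minnP _ y0 [in Y] (dist x) y0Y.
rewrite /gate; case: pickP => [q /andP[qY /forall_inP]|/(_ p)/negP[]] //.
apply/andP; split=> //; apply/forall_inP=> y yY; apply/eqP.
have [m [E1 E2 E3]] := medianE medG x p y.
have /min_p le_pm : m \in Y.
  by apply: (cY p y) => //; apply/betweenP.
have pm : p = m by apply: (dist_eq0 conn); rewrite symd; lia.
by subst m.
Qed.

Lemma gate_in Y x : convex Y -> gate Y x \in Y.
Proof. by case/(gateP x). Qed.

Lemma gate_dist Y x y :
  convex Y -> y \in Y -> dist x y = dist x (gate Y x) + dist (gate Y x) y.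
Proof. by case/(gateP x)=> _ gP /gP /betweenP. Qed.

Lemma gate_uniq Y x p :
  convex Y -> p \in Y -> {in Y, forall y, between x p y} -> gate Y x = p.
Proof.
move=> cY pY pP; have /betweenP := pP _ (gate_in x cY).
rewrite (gate_dist x cY pY) => E; apply: (dist_eq0 conn); lia.
Qed.

Lemma gate_id Y x : convex Y -> x \in Y -> gate Y x = x.
Proof. by move=> cY xY; apply: gate_uniq => // y _; apply/betweenP; rewrite distxx. Qed.

Lemma gate_lipschitz Y x y :
  convex Y -> dist (gate Y x) (gate Y y) <= dist x y.
Proof.
move=> cY; have := gate_dist x cY (gate_in y cY); have := gate_dist y cY (gate_in x cY).
have := tri y x (gate Y y); have := tri x y (gate Y x).
by have := symd x y; have := symd (gate Y x) (gate Y y); lia.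
Qed.

Lemma convex_between Y x y z :
  convex Y -> x \in Y -> y \in Y -> between x z y -> z \in Y.
Proof. by case/(between_convexP conn)=> _ cY; apply: cY. Qed.

(** * Theta-classes *)

(** The class of an edge, as it appears in [theta_classes]. *)
Definition class_of (E : {set G}) : {set {set G}} := [set F in edges G | theta E F].

Lemma in_class_ofE E F : (F \in class_of E) = (F \in edges G) && theta E F.
Proof. exact: in_set. Qed.

Lemma theta_classesP C :
  reflect (exists a b, adj a b /\ C = class_of [set a; b]) (C \in theta_classes G).
Proof.
apply: (iffP imsetP) => [[E /edgesP[a [b [ab ->]]] ->]|[a [b [ab ->]]]].
  by exists a, b.
by exists [set a; b] => //; apply/edgesP; exists a, b.
Qed.

Lemma class_of_in a b : adj a b -> class_of [set a; b] \in theta_classes G.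
Proof. by move=> ab; apply/theta_classesP; exists a, b. Qed.

Lemma in_class_of a b x y :
  adj x y -> ([set x; y] \in class_of [set a; b]) = th a b x y.
Proof.
move=> xy; rewrite in_set theta_set2 //.
by have -> : [set x; y] \in edges G by apply/edgesP; exists x, y.
Qed.

Lemma class_of_eq a b x y :
  adj a b -> adj x y -> (class_of [set a; b] == class_of [set x; y]) = th a b x y.
Proof.
move=> ab xy; apply/eqP/idP => [E|T].
  by rewrite -(in_class_of a b xy) E (in_class_of x y xy) th_refl.
apply/setP=> F; rewrite [LHS]in_class_ofE [RHS]in_class_ofE.
case Fe: (F \in edges G); last by rewrite !andFb.
have /edgesP[u [v [uv ->]]] := Fe; rewrite !andTb (theta_set2 a) (theta_set2 x).
 apply/idP/idP; last exact: th_trans.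
by apply: th_trans => //; rewrite th_sym.
Qed.

Lemma class_crossesP a b Y :
  reflect (exists x y, [/\ adj x y, x \in Y, y \in Y & th a b x y])
          (class_crosses (class_of [set a; b]) Y).
Proof.
apply: (iffP exists_inP) => [[E]|[x [y [xy xY yY T]]]].
  rewrite in_set => /andP[/edgesP[x [y [xy ->]]]]; rewrite theta_set2 // subUset !sub1set.
  by move=> T /andP[xY yY]; exists x, y.
by exists [set x; y]; rewrite ?in_class_of // subUset !sub1set xY.
Qed.

Lemma parallelP Y Z :
  parallel Y Z <->
  (forall a b, adj a b -> a \in Y -> b \in Y ->
     exists x y, [/\ adj x y, x \in Z, y \in Z & th a b x y]) /\
  (forall a b, adj a b -> a \in Z -> b \in Z ->
     exists x y, [/\ adj x y, x \in Y, y \in Y & th a b x y]).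
Proof.
split=> [par|[YZ ZY] C /theta_classesP[a [b [ab ->]]]].
  split=> a b ab aY bY; apply/class_crossesP.
    by rewrite -par ?class_of_in //; apply/class_crossesP; exists a, b; rewrite th_refl.
  by rewrite par ?class_of_in //; apply/class_crossesP; exists a, b; rewrite th_refl.
apply/class_crossesP/class_crossesP=> -[x [y [xy xY yY T]]].
  have [u [v [uv uZ vZ T']]] := YZ _ _ xy xY yY.
  by exists u, v; split=> //; apply: th_trans T T'.
have [u [v [uv uZ vZ T']]] := ZY _ _ xy xY yY.
by exists u, v; split=> //; apply: th_trans T T'.
Qed.

Lemma parallel_sym Y Z : parallel Y Z -> parallel Z Y.
Proof. by move=> par C /par ->. Qed.

(** A class separating x in Y' from the gate back in Y' crosses Y' and so Y;
    but no halfspace whose wall crosses Y separates a vertex from its gate in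
    Y. *)
Lemma gateK Y Y' x :
  convex Y -> convex Y' -> parallel Y Y' -> x \in Y' -> gate Y' (gate Y x) = x.
Proof.
move=> cY cY' /parallelP[_ par] xY'; set y := gate Y x; set z := gate Y' y.
have zY' : z \in Y' by apply: gate_in.
case E: (dist x z) => [|k]; first by rewrite (dist_eq0 conn E).
have [x1 xx1 x1z] := dist_step conn E; have xx1' := (adj1 _ _).1 xx1.
have x1Y' : x1 \in Y'.
  by apply: (convex_between cY' xY' zY'); apply/betweenP; rewrite E x1z xx1'.
have [e1 [e2 [e12 e1Y e2Y T]]] := par _ _ xx1 xY' x1Y'.
have nz : ~~ side x x1 z by rewrite /side (symd z x) (symd z x1); lia.
have sx := side_l medG xx1.
have y_in : side x x1 y.
  have [e [eY se]] : exists e, e \in Y /\ side x x1 e.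
    move: T; rewrite th_side //; case E1: (side x x1 e1); first by exists e1.
    by case E2: (side x x1 e2) => // _; exists e2.
  by apply: (side_convex medG xx1 sx se); apply/betweenP/gate_dist.
case/negP: nz; apply: (side_convex medG xx1 y_in sx).
by apply/betweenP/gate_dist.
Qed.

(** The two projections are 1-Lipschitz and inverse to each other. *)
Lemma gate_isometric Y Y' x y :
  convex Y -> convex Y' -> parallel Y Y' -> x \in Y' -> y \in Y' ->
  dist (gate Y x) (gate Y y) = dist x y.
Proof.
move=> cY cY' par xY' yY'; apply/eqP; rewrite eqn_leq gate_lipschitz //.
by rewrite -{1}(gateK cY cY' par xY') -{1}(gateK cY cY' par yY') gate_lipschitz.
Qed.

Lemma gate_th Y x y :
  convex Y -> adj x y -> gate Y x != gate Y y -> th x y (gate Y x) (gate Y y).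
Proof.
move=> cY xy /eqP neq; rewrite /th.
rewrite (gate_dist x cY (gate_in y cY)) (gate_dist y cY (gate_in x cY)).
have := symd (gate Y x) (gate Y y).
by case E: (dist (gate Y x) _) => [|k]; [case: neq; apply: (dist_eq0 conn) | lia].
Qed.

End Gates.

(** * Comparing crossing graphs *)

(** Crossing graphs are compared through a correspondence between oriented
    edges; it may relate one edge to many, which suits graphs given by
    overlapping pieces. *)
Definition edge_correspondence (G H : sgraph) (R : G -> G -> H -> H -> Prop) :=
  [/\ forall a b, adj a b -> exists a' b', adj a' b' /\ R a b a' b',
      forall a b x y a' b' x' y',
        adj a b -> adj x y -> adj a' b' -> adj x' y' ->
        R a b a' b' -> R x y x' y' -> th a b x y = th a' b' x' y'
    & forall a b c d, square a b c d ->
        exists a' b' c' d', [/\ square a' b' c' d', R a b a' b' & R a d a' d']].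

Section CrossIso.
Variables (G H : sgraph) (R : G -> G -> H -> H -> Prop).
Hypotheses (medG : median G) (medH : median H).
Hypothesis corR : edge_correspondence R.

Definition class_rel (C : Cross G) (D : Cross H) :=
  exists a b a' b', [/\ adj a b, adj a' b', val C = class_of [set a; b],
    val D = class_of [set a'; b'] & R a b a' b'].

Lemma class_rel_total C : exists D, class_rel C D.
Proof.
have [tot _ _] := corR; have /theta_classesP[a [b [ab EC]]] := valP C.
have [a' [b' [ab' r]]] := tot _ _ ab.
by exists (exist (fun D => D \in theta_classes H) _ (class_of_in ab')), a, b, a', b'.
Qed.

Lemma class_rel_eq C C' D D' :
  class_rel C D -> class_rel C' D' -> (C == C') = (D == D').
Proof.
case=> a [b [a' [b' [ab ab' E1 E2 r]]]] [x [y [x' [y' [xy xy' E3 E4 s]]]]].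
have [_ thR _] := corR.
have -> : (C == C') = (val C == val C') by [].
have -> : (D == D') = (val D == val D') by [].
by rewrite E1 E2 E3 E4 !class_of_eq // (thR _ _ _ _ _ _ _ _ ab xy ab' xy' r s).
Qed.

Lemma class_rel_cross C C' D D' :
  class_rel C D -> class_rel C' D' -> cross (val C) (val C') -> cross (val D) (val D').
Proof.
move=> rC rC' /andP[neqC /existsP[a /existsP[b /existsP[c /existsP[d]]]]].
case/and3P=> sq abC adC'; apply/andP; split.
  by move: neqC; rewrite !val_eqE (class_rel_eq rC rC').
have [_ thR sqR] := corR; have [a' [b' [c' [d' [sq' r r']]]]] := sqR _ _ _ _ sq.
apply/existsP; exists a'; apply/existsP; exists b'; apply/existsP; exists c'.
apply/existsP; exists d'; rewrite sq' /=.
move: sq sq' => /and5P[ab _ _ + _] /and5P[ab' _ _ + _]; rewrite adj_sym => ad; rewrite adj_sym => ad'.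
have [x [y [x' [y' [xy xy' EC ED s]]]]] := rC.
have [u [v [u' [v' [uv uv' EC' ED' t]]]]] := rC'.
move: abC adC'; rewrite EC ED EC' ED' !in_class_of //.
by rewrite (thR _ _ _ _ _ _ _ _ xy ab xy' ab' s r) (thR _ _ _ _ _ _ _ _ uv ad uv' ad' t r') => -> ->.
Qed.

End CrossIso.

Lemma Cross_iso (G H : sgraph) (R : G -> G -> H -> H -> Prop) :
  median G -> median H -> edge_correspondence R ->
  edge_correspondence (fun a b c d => R c d a b) -> isomorphic (Cross G) (Cross H).
Proof.
move=> medG medH cor cor'.
have [f fP] := fin_all_exists (class_rel_total cor).
have [g gP] := fin_all_exists (class_rel_total cor').
have flip C D : class_rel (fun a b c d => R c d a b) D C -> class_rel R C D.
  by case=> a [b [a' [b' [ab ab' E1 E2 r]]]]; exists a', b', a, b.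
have unflip C D : class_rel R C D -> class_rel (fun a b c d => R c d a b) D C.
  by case=> a [b [a' [b' [ab ab' E1 E2 r]]]]; exists a', b', a, b.
exists f; split.
  exists g => C; apply/eqP; rewrite eq_sym.
    by rewrite (class_rel_eq medG medH cor (fP C) (flip _ _ (gP (f C)))).
  by rewrite (class_rel_eq medH medG cor' (gP C) (unflip _ _ (fP (g C)))).
move=> C D; apply/idP/idP.
  exact: (class_rel_cross medH medG cor' (unflip _ _ (fP C)) (unflip _ _ (fP D))).
exact: (class_rel_cross medG medH cor (fP C) (fP D)).
Qed.


(** * Isomorphisms *)

Lemma isomorphic_refl G : isomorphic G G.
Proof. by exists id; split=> //; exists id. Qed.

Lemma isomorphic_sym G H : isomorphic G H -> isomorphic H G.
Proof.
case=> f [[g fK gK] f_adj]; exists g; split; first by exists f.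
by move=> x y; rewrite -f_adj !gK.
Qed.

Lemma isomorphic_trans H G K : isomorphic G H -> isomorphic H K -> isomorphic G K.
Proof.
case=> f [bf f_adj] [g [bg g_adj]]; exists (g \o f); split; first exact: bij_comp.
by move=> x y; rewrite /= g_adj f_adj.
Qed.

(** * Graphs covered by two pieces *)

(** The intrinsic form of an amalgam: two embedded graphs whose images cover
    all vertices and all edges; the pieces are glued wherever the images
    meet. *)
Definition amalgamated (A B G : sgraph) (f : A -> G) (g : B -> G) : Prop :=
  [/\ injective f /\ injective g,
      {mono f : x y / adj x y} /\ {mono g : x y / adj x y},
      forall u, (exists x, u = f x) \/ (exists y, u = g y)
    & forall u v, adj u v ->
        (exists x y, u = f x /\ v = f y) \/ (exists x y, u = g x /\ v = g y)].

Definition glued_along (A B G : sgraph) (Y : {set A}) (phi : A -> B)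
    (f : A -> G) (g : B -> G) : Prop :=
  amalgamated f g /\ forall x y, f x = g y <-> x \in Y /\ y = phi x.

Section AmalgamPieces.
Variables (A B : sgraph) (Y1 : {set A}) (Y2 : {set B}) (phi : A -> B).
Hypothesis iso_phi : iso_on Y1 Y2 phi.
Implicit Types u v w : (A + B)%type.

Lemma glue_eqE u v : glue_eq Y1 phi u v = [|| u == v, glue Y1 phi u v | glue Y1 phi v u].
Proof.
have [inj_phi _ _] := iso_phi.
apply/idP/idP => [/connectP[p + ->] {v}|]; last first.
  by case/orP=> [/eqP ->|uv]; [exact: connect0 | apply: connect1].
elim: p u => [|v p IH] u /=; first by rewrite eqxx.
case/andP=> step /IH {IH}; move: (last v p) => w.
case: u v w step => [a|b] [a'|b'] [a''|b''] //=; rewrite ?orbF //.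
- move=> /andP[aY /eqP ->] /andP[aY'' /eqP E].
  by rewrite (inj_phi _ _ aY aY'' E) eqxx.
- by move=> gab /eqP[<-]; rewrite gab.
- by move=> gab /eqP[<-]; rewrite gab ?orbT.
- by move=> /andP[_ /eqP ->] /andP[_ /eqP ->]; rewrite eqxx.
Qed.

Lemma glue_eq_sym u v : glue_eq Y1 phi u v = glue_eq Y1 phi v u.
Proof. by rewrite !glue_eqE eq_sym; congr (_ || _); rewrite orbC. Qed.

Lemma glue_eq_trans u v w :
  glue_eq Y1 phi u v -> glue_eq Y1 phi v w -> glue_eq Y1 phi u w.
Proof. exact: connect_trans. Qed.

Definition amalgam_point u : amalgam Y1 phi :=
  exist (fun p => p \in equivalence_partition (glue_eq Y1 phi) setT)
    [set v in setT | glue_eq Y1 phi u v] (imset_f _ (in_setT u)).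

Lemma in_amalgam_point u v : (v \in val (amalgam_point u)) = glue_eq Y1 phi u v.
Proof. by rewrite /= !inE. Qed.

Lemma amalgam_point_eq u v : (amalgam_point u = amalgam_point v) <-> glue_eq Y1 phi u v.
Proof.
split=> [E|uv]; first by rewrite -in_amalgam_point E in_amalgam_point; exact: connect0.
apply/val_inj/setP=> w; rewrite !in_amalgam_point; apply/idP/idP; apply: glue_eq_trans => //.
by rewrite glue_eq_sym.
Qed.

Lemma amalgam_point_surj (p : amalgam Y1 phi) : exists u, p = amalgam_point u.
Proof. by have /imsetP[u _ E] := valP p; exists u; apply: val_inj. Qed.

Lemma amalgam_pointP (p : amalgam Y1 phi) u : u \in val p -> p = amalgam_point u.
Proof.
by have [v ->] := amalgam_point_surj p; rewrite in_amalgam_point => /amalgam_point_eq.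
Qed.

Lemma adj_amalgam_point (p q : amalgam Y1 phi) :
  adj p q -> exists u v, [/\ p = amalgam_point u, q = amalgam_point v & sum_adj u v].
Proof.
case/andP=> _ /exists_inP[u /amalgam_pointP -> /exists_inP[v /amalgam_pointP -> uv]].
by exists u, v.
Qed.

Lemma amalgam_point_adj u v : sum_adj u v -> adj (amalgam_point u) (amalgam_point v).
Proof.
have [_ _ mono_phi] := iso_phi.
move=> uv; apply/andP; split; last first.
  apply/exists_inP; exists u; first by rewrite in_amalgam_point; exact: connect0.
  by apply/exists_inP; exists v => //; rewrite in_amalgam_point; exact: connect0.
apply/negP=> /eqP /amalgam_point_eq; rewrite glue_eqE.
case: u v uv => [a|b] [a'|b'] //= ab; rewrite orbF => /eqP[E];
  by rewrite E adj_irrefl in ab.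
Qed.

Lemma amalgam_pieces :
  exists (f : A -> amalgam Y1 phi) (g : B -> amalgam Y1 phi), glued_along Y1 phi f g.
Proof.
have [inj_phi _ mono_phi] := iso_phi.
exists (amalgam_point \o inl), (amalgam_point \o inr).
have eqlr x y : amalgam_point (inl x) = amalgam_point (inr y) <-> x \in Y1 /\ y = phi x.
  split=> [/amalgam_point_eq|[xY ->]]; last first.
    by apply/amalgam_point_eq; rewrite glue_eqE /= xY eqxx.
  by rewrite glue_eqE /= orbF => /andP[xY /eqP ->].
have eqll x y : amalgam_point (inl x) = amalgam_point (inl y) -> x = y.
  by move=> /amalgam_point_eq; rewrite glue_eqE /= orbF => /eqP[].
have eqrr x y : amalgam_point (inr x) = amalgam_point (inr y) -> x = y.
  by move=> /amalgam_point_eq; rewrite glue_eqE /= orbF => /eqP[].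
split=> //; split=> //.
- split=> x y /=; apply/idP/idP; try exact: (@amalgam_point_adj (inl x) (inl y));
    try exact: (@amalgam_point_adj (inr x) (inr y)).
    move=> /adj_amalgam_point[[a|b] [[a'|b']]] [] //=; first by move=> /eqll -> /eqll ->.
    by move=> /eqlr[xY ->] /eqlr[yY ->]; rewrite mono_phi.
  move=> /adj_amalgam_point[[a|b] [[a'|b']]] [] //=; last by move=> /eqrr -> /eqrr ->.
  by move=> /esym/eqlr[xY ->] /esym/eqlr[yY ->]; rewrite mono_phi.
- by move=> u; have [[a|b] ->] := amalgam_point_surj u; [left; exists a | right; exists b].
move=> u v /adj_amalgam_point[[a|b] [[a'|b']]] [] // -> -> _.
  by left; exists a, a'.
by right; exists b, b'.
Qed.

End AmalgamPieces.

(** An amalgam is determined by which pairs of vertices are glued; this lets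
    amalgams be handled through their pieces, without quotients. *)

Section AmalgamUnique.
Variables (A B : sgraph).

Definition same_piece (G H : sgraph) (f : A -> G) (g : B -> G) (f' : A -> H) (g' : B -> H)
    (u : G) (u' : H) :=
  (exists2 x, u = f x & u' = f' x) \/ (exists2 y, u = g y & u' = g' y).

Lemma same_piece_eq (G H : sgraph) (f : A -> G) (g : B -> G) (f' : A -> H) (g' : B -> H) u u' v v' :
  amalgamated f g -> amalgamated f' g' -> (forall x y, f x = g y <-> f' x = g' y) ->
  same_piece f g f' g' u u' -> same_piece f g f' g' v v' -> u = v -> u' = v'.
Proof.
move=> [[fI gI] _ _ _] [[fI' gI'] _ _ _] fg [[x -> ->]|[y -> ->]] [[x' -> ->]|[y' -> ->]].
- by move/fI->.
- by move/fg.
- by move/esym/fg.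
- by move/gI->.
Qed.

Lemma same_piece_adj (G H : sgraph) (f : A -> G) (g : B -> G) (f' : A -> H) (g' : B -> H) u u' v v' :
  amalgamated f g -> amalgamated f' g' -> (forall x y, f x = g y <-> f' x = g' y) ->
  same_piece f g f' g' u u' -> same_piece f g f' g' v v' -> adj u v -> adj u' v'.
Proof.
move=> am am' fg uu' vv' uv; have [_ [fm gm] _ edge] := am; have [_ [fm' gm'] _ _] := am'.
case: (edge _ _ uv) => -[x [y [E1 E2]]].
  rewrite (same_piece_eq am am' fg uu' _ E1 (v' := f' x)); last by left; exists x.
  rewrite (same_piece_eq am am' fg vv' _ E2 (v' := f' y)); last by left; exists y.
  by rewrite fm' -fm -E1 -E2.
rewrite (same_piece_eq am am' fg uu' _ E1 (v' := g' x)); last by right; exists x.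
rewrite (same_piece_eq am am' fg vv' _ E2 (v' := g' y)); last by right; exists y.
by rewrite gm' -gm -E1 -E2.
Qed.

Lemma amalgamated_unique (G H : sgraph) (f : A -> G) (g : B -> G) (f' : A -> H) (g' : B -> H) :
  amalgamated f g -> amalgamated f' g' -> (forall x y, f x = g y <-> f' x = g' y) ->
  isomorphic G H.
Proof.
move=> am am' fg; have gf x y : f' x = g' y <-> f x = g y by rewrite fg.
have [_ _ cov _] := am; have [_ _ cov' _] := am'.
have [|h hP] := @fin_all_exists G _ (same_piece f g f' g').
  by move=> u; case: (cov u) => -[x ->]; [exists (f' x); left | exists (g' x); right]; exists x.
have [|k kP] := @fin_all_exists H _ (same_piece f' g' f g).
  by move=> u; case: (cov' u) => -[x ->]; [exists (f x); left | exists (g x); right]; exists x.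
have flip u v : same_piece f g f' g' u v -> same_piece f' g' f g v u.
  by case=> -[x]; [left | right]; exists x.
have unflip u v : same_piece f' g' f g u v -> same_piece f g f' g' v u.
  by case=> -[x]; [left | right]; exists x.
exists h; split.
  exists k => u.
    exact: (same_piece_eq am' am gf (kP (h u)) (flip _ _ (hP u))).
  exact: (same_piece_eq am am' fg (hP (k u)) (unflip _ _ (kP u))).
move=> u v; apply/idP/idP.
  exact: (same_piece_adj am' am gf (flip _ _ (hP u)) (flip _ _ (hP v))).
exact: (same_piece_adj am am' fg (hP u) (hP v)).
Qed.

End AmalgamUnique.

Lemma isomorphic_amalgam (A B P : sgraph) (Y1 : {set A}) (Y2 : {set B}) (phi : A -> B) :
  iso_on Y1 Y2 phi ->
  isomorphic P (amalgam Y1 phi) <->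
  exists (f : A -> P) (g : B -> P), glued_along Y1 phi f g.
Proof.
move=> iso_phi; have [f [g [am fg]]] := amalgam_pieces iso_phi.
split=> [[h [[k hK kK] h_adj]]|[f' [g' [am' fg']]]]; last first.
  apply: (amalgamated_unique am' am) => x y.
  by split=> [/fg' /fg|/fg /fg'].
have kI := can_inj kK; have [[fI gI] [fm gm] cov edge] := am.
exists (k \o f), (k \o g); split; last first.
  by move=> x y; rewrite -fg; split=> [/kI|/= ->].
split; first by split; apply: inj_comp.
- by split=> x y; rewrite /= -h_adj !kK.
- move=> u; case: (cov (h u)) => -[x E]; [left | right]; exists x; by rewrite /= -E hK.
move=> u v; rewrite -h_adj => /edge[] [x [y [E1 E2]]]; [left | right]; exists x, y;
  by rewrite /= -E1 -E2 !hK.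
Qed.


(** * The metric of an amalgam *)

Definition overlap (A B G : sgraph) (f : A -> G) (g : B -> G) : {set A} :=
  [set x | [exists y, f x == g y]].

Lemma overlapP (A B G : sgraph) (f : A -> G) (g : B -> G) x :
  reflect (exists y, f x = g y) (x \in overlap f g).
Proof.
by rewrite inE; apply: (iffP existsP) => -[y]; [move/eqP|move=> ->]; exists y.
Qed.

Definition median_amalgam (A B G : sgraph) (f : A -> G) (g : B -> G) : Prop :=
  [/\ median A, median B, amalgamated f g, convex (overlap f g)
    & convex (overlap g f)].

Lemma median_amalgam_sym (A B G : sgraph) (f : A -> G) (g : B -> G) :
  median_amalgam f g -> median_amalgam g f.
Proof.
case=> medA medB [[fI gI] [fm gm] cov edge] cf cg; split=> //; split=> //.
  by move=> u; case: (cov u); [right | left].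
by move=> u v /edge[]; [right | left].
Qed.

Lemma glued_overlap (A B G : sgraph) (Y1 : {set A}) (phi : A -> B)
    (f : A -> G) (g : B -> G) :
  glued_along Y1 phi f g -> overlap f g = Y1 /\ overlap g f = phi @: Y1.
Proof.
case=> _ fg; split; apply/setP=> x.
  by apply/overlapP/idP=> [[y /fg[]] //|xY]; exists (phi x); apply/fg.
apply/overlapP/imsetP=> [[y /esym/fg[yY ->]]|[y yY ->]]; exists y => //.
by apply/esym/fg.
Qed.

Lemma glued_median_amalgam (A B G : sgraph) (Y1 : {set A}) (Y2 : {set B})
    (phi : A -> B) (f : A -> G) (g : B -> G) :
  median A -> median B -> convex Y1 -> convex Y2 -> iso_on Y1 Y2 phi ->
  glued_along Y1 phi f g -> median_amalgam f g.
Proof.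
move=> medA medB c1 c2 [_ im_phi _] gl; have [E1 E2] := glued_overlap gl.
by split; rewrite ?E1 ?E2 ?im_phi //; case: gl.
Qed.

Section AmalgamMetric.
Variables (A B G : sgraph) (f : A -> G) (g : B -> G).
Hypothesis am : median_amalgam f g.

Let medA : median A. Proof. by case: am. Qed.
Let medB : median B. Proof. by case: am. Qed.
Let connA : connected A := medA.1.
Let connB : connected B := medB.1.
Let cvxA : convex (overlap f g). Proof. by case: am. Qed.
Let cvxB : convex (overlap g f). Proof. by case: am. Qed.

Lemma amalgam_connect_l x y : connect (@adj G) (f x) (f y).
Proof.
have [_ _ [_ [fm _] _ _] _ _] := am.
have /connectP[p xp ->] := connA.2 x y.
apply/connectP; exists (map f p); last by rewrite last_map.
by elim: p x xp => //= z p IH x /andP[xz /IH ->]; rewrite fm xz.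
Qed.

(** Geodesics of the left piece between vertices of the overlap stay in the
    overlap, hence are walks of the right piece. *)
Lemma overlap_le x x' y y' : f x = g y -> f x' = g y' -> dist y y' <= dist x x'.
Proof.
have [_ _ [[_ gI] [fm gm] _ _] _ _] := am.
move E: (dist x x') => n; elim: n x y E => [|n IH] x y E fxy fxy'.
  by move: fxy; rewrite (dist_eq0 connA E) fxy' => /gI ->; rewrite distxx.
have [x1 xx1 x1n] := dist_step connA E.
have /overlapP[y1 fxy1] : x1 \in overlap f g.
  have xO : x \in overlap f g by apply/overlapP; exists y.
  have xO' : x' \in overlap f g by apply/overlapP; exists y'.
  by apply: (convex_between medA cvxA xO xO'); apply/betweenP; rewrite E x1n ((adj_dist1 connA _ _).1 xx1).
have yy1 : adj y y1 by rewrite -gm -fxy -fxy1 fm.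
have := IH _ _ x1n fxy1 fxy'; have := dist_triangle connB y1 y y'.
by rewrite ((adj_dist1 connB _ _).1 yy1); lia.
Qed.

End AmalgamMetric.

Section AmalgamDist.
Variables (A B G : sgraph) (f : A -> G) (g : B -> G).
Hypothesis am : median_amalgam f g.

Let medA : median A. Proof. by case: am. Qed.
Let medB : median B. Proof. by case: am. Qed.
Let connA : connected A := medA.1.
Let connB : connected B := medB.1.
Let cvxA : convex (overlap f g). Proof. by case: am. Qed.
Let cvxB : convex (overlap g f). Proof. by case: am. Qed.
Local Notation gateB := (gate (overlap g f)).

Lemma overlap_isometric x x' y y' : f x = g y -> f x' = g y' -> dist y y' = dist x x'.
Proof.
move=> E E'; apply/eqP; rewrite eqn_leq (overlap_le am) //.
by rewrite (overlap_le (median_amalgam_sym am)).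
Qed.

Lemma amalgam_connected : connected G.
Proof.
have /andP[/set0Pn[x0 /overlapP[y0 E0]] _] : (overlap f g != set0) && true.
  by case: cvxA => ->.
have to0 u : connect (@adj G) u (f x0) /\ connect (@adj G) (f x0) u.
  have [_ _ [_ _ cov _] _ _] := am.
  case: (cov u) => -[x ->]; first by split; exact: amalgam_connect_l am _ _.
  by rewrite E0; split; exact: amalgam_connect_l (median_amalgam_sym am) _ _.
split; first by apply/card_gt0P; exists (f x0).
by move=> u v; exact: connect_trans (to0 u).1 (to0 v).2.
Qed.

Let connG := amalgam_connected.

Lemma amalgam_dist_le_l x y : dist (f x) (f y) <= dist x y.
Proof.
have [_ _ [_ [fm _] _ _] _ _] := am.
apply: (lipschitz_le_dist connA (F := fun z => dist (f x) (f z))); first exact: distxx.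
move=> u v uv; rewrite -((adj_dist1 connG (f u) (f v)).1 _) ?fm //.
exact: dist_triangle.
Qed.

Lemma exit_point y : exists x, f x = g (gateB y).
Proof. by have /overlapP[x ->] := gate_in medB y cvxB; exists x. Qed.

(** The function F sends a vertex of the right piece to the length of the route
    from x through its gate. It grows by at most one along each edge because
    gates are 1-Lipschitz and the overlap has the same metric in both pieces. *)
Lemma amalgam_dist_ge x :
  (forall y, dist x y <= dist (f x) (f y)) /\
  (forall y z, f z = g (gateB y) -> dist x z + dist (gateB y) y <= dist (f x) (g y)).
Proof.
have [_ _ [[fI gI] [fm gm] cov edge] _ _] := am.
have [F FP] : exists F : G -> nat, forall u, (forall y, u = f y -> F u = dist x y) /\
    (forall y z, u = g y -> f z = g (gateB y) -> F u = dist x z + dist (gateB y) y).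
  apply: (@fin_all_exists G (fun=> nat) (fun u n => (forall y, u = f y -> n = dist x y) /\
    (forall y z, u = g y -> f z = g (gateB y) -> n = dist x z + dist (gateB y) y))) => u.
  have in_overlap a b : f a = g b -> gateB b = b.
    by move=> E; apply: gate_id => //; apply/overlapP; exists a.
  case: (cov u) => -[a ->].
    exists (dist x a); split=> [y /fI -> //|y z E]; rewrite (in_overlap _ _ E) -E.
    by move/fI ->; rewrite distxx addn0.
  have [b Eb] := exit_point a; exists (dist x b + dist (gateB a) a).
  split=> [y E|y z /gI <-]; last by rewrite -Eb => /fI ->.
  by move: Eb; rewrite (in_overlap _ _ (esym E)) E => /fI ->; rewrite distxx addn0.
have lip u v : adj u v -> F v <= F u + 1.
  move=> uv; case: (edge _ _ uv) => -[a [b [Eu Ev]]].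
    rewrite ((FP u).1 a Eu) ((FP v).1 b Ev).
    have /(adj_dist1 connA) <- : adj a b by rewrite -fm -Eu -Ev.
    exact: dist_triangle.
  have [z Ez] := exit_point a; have [z' Ez'] := exit_point b.
  rewrite ((FP u).2 a z Eu Ez) ((FP v).2 b z' Ev Ez').
  have /(adj_dist1 connB) ab : adj a b by rewrite -gm -Eu -Ev.
  have := dist_triangle connA z x z'; rewrite -(overlap_isometric Ez Ez').
  have := gate_dist medB b cvxB (gate_in medB a cvxB).
  have := dist_triangle connB a b (gateB a).
  rewrite (dist_sym connB b a) ab (dist_sym connB (gateB b) (gateB a)).
  by rewrite (dist_sym connB (gateB a) a) (dist_sym connB (gateB b) b); clear; lia.
have Fx : F (f x) = 0 by rewrite ((FP (f x)).1 x erefl) distxx.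
split=> y; first by rewrite -((FP (f y)).1 _ erefl); apply: lipschitz_le_dist.
by move=> z E; rewrite -((FP (g y)).2 _ _ erefl E); apply: lipschitz_le_dist.
Qed.

Lemma amalgam_isometric_l x y : dist (f x) (f y) = dist x y.
Proof. by apply/eqP; rewrite eqn_leq amalgam_dist_le_l (amalgam_dist_ge x).1. Qed.

End AmalgamDist.

Section AmalgamMedian.
Variables (A B G : sgraph) (f : A -> G) (g : B -> G).
Hypothesis am : median_amalgam f g.

Let medA : median A. Proof. by case: am. Qed.
Let medB : median B. Proof. by case: am. Qed.
Let cvxB : convex (overlap g f). Proof. by case: am. Qed.
Let connG := amalgam_connected am.
Local Notation gateB := (gate (overlap g f)).

Lemma amalgam_isometric_r x y : dist (g x) (g y) = dist x y.
Proof. exact: amalgam_isometric_l (median_amalgam_sym am) x y. Qed.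

Lemma amalgam_dist x y z :
  f z = g (gateB y) -> dist (f x) (g y) = dist x z + dist (gateB y) y.
Proof.
move=> E; apply/eqP; rewrite eqn_leq ((amalgam_dist_ge am x).2 _ _ E) andbT.
have := dist_triangle connG (f z) (f x) (g y).
by rewrite {2}E amalgam_isometric_r (amalgam_isometric_l am).
Qed.

Definition has_median u v w := exists! m : G,
  [/\ dist u v = dist u m + dist m v, dist u w = dist u m + dist m w
    & dist v w = dist v m + dist m w].

(** Seen from the left piece, every vertex of the amalgam is its exit point up to
    a constant, so medians are computed inside that piece. *)
Lemma has_median_l x y w : has_median (f x) (f y) w.
Proof.
have [_ _ [_ _ cov _] _ _] := am; have symA := dist_sym medA.1.
have [p [c Ep]] : exists p c, forall a, dist (f a) w = dist a p + c.
  case: (cov w) => -[z ->]; first by exists z, 0 => a; rewrite (amalgam_isometric_l am) addn0.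
  have [p Ep] := exit_point am z.
  by exists p, (dist (gateB z) z) => a; rewrite (amalgam_dist a Ep).
have [m [mP m_uniq]] := medA.2 x y p.
exists (f m); split=> [|n [n1 n2 n3]].
  by case: mP => *; split; rewrite ?Ep ?(amalgam_isometric_l am); lia.
(* A vertex outside the left piece lies on no geodesic from x to y, because its
   exit point is strictly closer to both. *)
have [a En] : exists a, n = f a.
  case: (cov n) => -[b En]; first by exists b.
  have [q Eq] := exit_point am b; exists q; rewrite Eq En; congr g.
  apply: (dist_eq0 medB.1); rewrite (dist_sym medB.1).
  move: n1; rewrite En (dist_sym connG (g b)) !(amalgam_dist _ Eq) (amalgam_isometric_l am).
  by have := dist_triangle medA.1 q x y; rewrite (symA q y); lia.
rewrite En; congr f; apply: m_uniq; move: n1 n2 n3; rewrite En !Ep !(amalgam_isometric_l am).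
by move=> *; split; lia.
Qed.

End AmalgamMedian.

Lemma has_median_perm (G : sgraph) (u v w : G) :
  connected G -> has_median u v w -> has_median u w v /\ has_median v u w.
Proof.
move=> conn [m [[m1 m2 m3] uniq]]; have symd := dist_sym conn.
have sym3 n : [/\ dist u n = dist n u, dist v n = dist n v & dist w n = dist n w] by [].
have [_ uv uw] := sym3 u; have [_ _ vw] := sym3 v; have [um vm wm] := sym3 m.
split; exists m; split=> [|n [n1 n2 n3]].
- by split; lia.
- by have [un vn wn] := sym3 n; apply: uniq; split; lia.
- by split; lia.
by have [un vn wn] := sym3 n; apply: uniq; split; lia.
Qed.

(** Two of any three vertices lie in the same piece. *)
Lemma amalgam_median (A B G : sgraph) (f : A -> G) (g : B -> G) :
  median_amalgam f g -> median G.
Proof.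
move=> am; have am' := median_amalgam_sym am; have conn := amalgam_connected am.
split=> // u v w; rewrite -/(has_median u v w); have [_ _ [_ _ cov _] _ _] := am.
have perm a b c := @has_median_perm G a b c conn.
case: (cov u) (cov v) (cov w) => -[a ->] [] [b ->] [] [c ->].
- exact: has_median_l am _ _ _.
- exact: has_median_l am _ _ _.
- by apply: (perm _ _ _ _).1; exact: has_median_l am _ _ _.
- by apply: (perm _ _ _ _).2; apply: (perm _ _ _ _).1; exact: has_median_l am' _ _ _.
- by apply: (perm _ _ _ _).2; apply: (perm _ _ _ _).1; exact: has_median_l am _ _ _.
- by apply: (perm _ _ _ _).1; exact: has_median_l am' _ _ _.
- exact: has_median_l am' _ _ _.
- exact: has_median_l am' _ _ _.
Qed.


(** * Theta-classes and squares of an amalgam *)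

Lemma square_embed (A G : sgraph) (f : A -> G) a b c d :
  injective f -> {mono f : x y / adj x y} ->
  square (f a) (f b) (f c) (f d) = square a b c d.
Proof. by move=> fI fm; rewrite /square !fm !(inj_eq fI). Qed.

Lemma square_rot (G : sgraph) (a b c d : G) : square a b c d -> square b c d a.
Proof.
by case/and5P=> ab bc cd da /and4P[ac bd nac nbd]; rewrite /square bc cd da ab bd nbd eq_sym ac adj_sym nac.
Qed.

Section AmalgamClasses.
Variables (A B G : sgraph) (f : A -> G) (g : B -> G).
Hypothesis am : median_amalgam f g.

Let medA : median A. Proof. by case: am. Qed.
Let medB : median B. Proof. by case: am. Qed.
Let medG : median G := amalgam_median am.

Lemma th_l x y z w : th (f x) (f y) (f z) (f w) = th x y z w.
Proof. by rewrite /th !(amalgam_isometric_l am). Qed.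

Lemma th_r x y z w : th (g x) (g y) (g z) (g w) = th x y z w.
Proof. by rewrite /th !(amalgam_isometric_r am). Qed.

(** A class met by edges of both pieces crosses their overlap: project one of the
    two edges to the overlap. *)
Lemma th_across x y z w :
  adj x y -> adj z w ->
  th (f x) (f y) (g z) (g w) <->
  exists e1 e2 k1 k2, [/\ f e1 = g k1, f e2 = g k2, adj e1 e2, th x y e1 e2 & th k1 k2 z w].
Proof.
have [_ _ [_ [fm gm] _ _] cvxA cvxB] := am.
move=> xy zw; split=> [T|[e1 [e2 [k1 [k2 [E1 E2 e12 T T']]]]]]; last first.
  apply: (th_trans medG _ _ _ (x := f e1) (y := f e2)); rewrite ?fm ?gm ?th_l //.
  by rewrite E1 E2 th_r.
have [e1 E1] := exit_point am z; have [e2 E2] := exit_point am w.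
have Te : th x y e1 e2.
  move: T; rewrite /th (amalgam_dist am x E1) (amalgam_dist am x E2).
  by rewrite (amalgam_dist am y E1) (amalgam_dist am y E2); lia.
have de : dist e1 e2 = dist (gate (overlap g f) z) (gate (overlap g f) w).
  by rewrite -(overlap_isometric am E1 E2).
have e12 : dist e1 e2 = 1.
  have := gate_lipschitz medB z w cvxB; rewrite -de (adj_dist1 medB.1 _ _).1 //.
  case E: (dist e1 e2) => [|[|]] // _.
  by move: Te; rewrite (dist_eq0 medA.1 E) /th eqxx.
exists e1, e2, (gate (overlap g f) z), (gate (overlap g f) w); split=> //.
  exact/(adj_dist1 medA.1).
rewrite (th_sym medB) gate_th //; apply/eqP=> E.
by move: de; rewrite E distxx e12.
Qed.

(** The two neighbours of a lie in the right piece. If the corner opposite a did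
    not, it would be a left vertex between two overlap vertices, hence in the
    overlap by convexity. *)
Lemma square_piece_r a b c d :
  square a b c d -> ~ (exists x, a = f x) ->
  exists a' b' c' d', [/\ a = g a', b = g b', c = g c' & d = g d'].
Proof.
have [_ _ [[fI gI] [fm gm] cov edge] cvxA cvxB] := am.
move=> /and5P[ab bc cd da /and4P[ac bd nac nbd]] nfa.
have [[x [y [E _]]]|[a' [b' [Ea Eb]]]] := edge _ _ ab; first by case: nfa; exists x.
have [[x [y [_ E]]]|[d' [_ [Ed _]]]] := edge _ _ da; first by case: nfa; exists y.
have [[x [y [Ex Ey]]]|[_ [c' [_ Ec]]]] := edge _ _ bc; last by exists a', b', c', d'.
have [[z [w [Ez Ew]]]|[c' [_ [Ec _]]]] := edge _ _ cd; last by exists a', b', c', d'.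
have /overlapP[c' Ec] : y \in overlap f g.
  have xO : x \in overlap f g by apply/overlapP; exists b'; rewrite -Ex.
  have wO : w \in overlap f g by apply/overlapP; exists d'; rewrite -Ew.
  apply: (convex_between medA cvxA xO wO); apply/betweenP.
  move: bc cd bd nbd; rewrite Ez in Ey; rewrite Ex Ez Ew (fI _ _ Ey) !fm (inj_eq fI).
  move=> /(adj_dist1 medA.1) xy /(adj_dist1 medA.1) yw nxw naxw.
  have := dist_triangle medA.1 y x w; rewrite xy yw.
  case E: (dist x w) => [|[|[|]]] // _.
    by rewrite (dist_eq0 medA.1 E) eqxx in nxw.
  by rewrite ((adj_dist1 medA.1 _ _).2 E) in naxw.
by exists a', b', c', d'; rewrite -Ec.
Qed.

Lemma square_piece a b c d :
  square a b c d ->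
  (exists a' b' c' d', [/\ a = f a', b = f b', c = f c' & d = f d']) \/
  (exists a' b' c' d', [/\ a = g a', b = g b', c = g c' & d = g d']).
Proof.
have inf u : (exists x, u = f x) \/ ~ (exists x, u = f x).
  case: (boolP [exists x, u == f x]) => [/existsP[x /eqP]|/existsP no].
    by left; exists x.
  by right=> -[x E]; case: no; exists x; apply/eqP.
move=> sq; have sq1 := square_rot sq; have sq2 := square_rot sq1; have sq3 := square_rot sq2.
case: (inf a) => [[a' Ea]|/(square_piece_r sq)]; last by right.
case: (inf b) => [[b' Eb]|/(square_piece_r sq1)[b' [c' [d' [x [-> -> -> ->]]]]]]; last first.
  by right; exists x, b', c', d'.
case: (inf c) => [[c' Ec]|/(square_piece_r sq2)[c' [d' [x [y [-> -> -> ->]]]]]]; last first.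
  by right; exists x, y, c', d'.
case: (inf d) => [[d' Ed]|/(square_piece_r sq3)[d' [x [y [z [-> -> -> ->]]]]]]; last first.
  by right; exists x, y, z, d'.
by left; exists a', b', c', d'.
Qed.

End AmalgamClasses.

(** * Crossing graphs of two amalgams of the same pieces *)

Definition piece_edges (A B G H : sgraph) (f : A -> G) (g : B -> G) (f' : A -> H) (g' : B -> H)
    (a b : G) (a' b' : H) :=
  (exists x y, [/\ a = f x, b = f y, a' = f' x & b' = f' y]) \/
  (exists x y, [/\ a = g x, b = g y, a' = g' x & b' = g' y]).

(** What parallelism of the two attaching subgraphs gives: the class of an edge
    in the first overlap also meets the second one, at the edge glued to the
    same edge of the right piece. *)
Definition overlap_slides (A B G H : sgraph) (f : A -> G) (g : B -> G)
    (f' : A -> H) (g' : B -> H) :=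
  forall e1 e2 k1 k2, adj e1 e2 -> f e1 = g k1 -> f e2 = g k2 ->
  exists e1' e2', [/\ f' e1' = g' k1, f' e2' = g' k2, adj e1' e2' & th e1 e2 e1' e2'].

Lemma slide_th (A B G H : sgraph) (f : A -> G) (g : B -> G) (f' : A -> H) (g' : B -> H) x y z w :
  median_amalgam f g -> median_amalgam f' g' -> overlap_slides f g f' g' ->
  adj x y -> adj z w -> th (f x) (f y) (g z) (g w) -> th (f' x) (f' y) (g' z) (g' w).
Proof.
move=> am am' sl xy zw /(th_across am xy zw)[e1 [e2 [k1 [k2 [E1 E2 e12 T T']]]]].
have [e1' [e2' [E1' E2' e12' Te]]] := sl _ _ _ _ e12 E1 E2.
have [medA _ _ _ _] := am.
apply/(th_across am' xy zw); exists e1', e2', k1, k2; split=> //.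
exact: (th_trans medA xy e12 e12' T Te).
Qed.

Lemma piece_edges_correspondence (A B G H : sgraph)
    (f : A -> G) (g : B -> G) (f' : A -> H) (g' : B -> H) :
  median_amalgam f g -> median_amalgam f' g' ->
  overlap_slides f g f' g' -> overlap_slides f' g' f g ->
  edge_correspondence (piece_edges f g f' g').
Proof.
move=> am am' sl sl'.
have medG := amalgam_median am; have medH := amalgam_median am'.
have [_ _ [[fI gI] [fm gm] cov edge] _ _] := am.
have [_ _ [[fI' gI'] [fm' gm'] cov' edge'] _ _] := am'.
have mixed x y z w : adj x y -> adj z w ->
    th (f x) (f y) (g z) (g w) = th (f' x) (f' y) (g' z) (g' w).
  by move=> xy zw; apply/idP/idP; apply: slide_th.
split.
- move=> a b ab; case: (edge _ _ ab) => -[x [y [Ea Eb]]].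
    by exists (f' x), (f' y); split; [rewrite fm' -fm -Ea -Eb | left; exists x, y].
  by exists (g' x), (g' y); split; [rewrite gm' -gm -Ea -Eb | right; exists x, y].
- move=> a b x y a' b' x' y' ab xy _ _ r r'.
  case: r ab => -[p [q [-> -> -> ->]]]; case: r' xy => -[s [t [-> -> -> ->]]].
  + by rewrite (th_l am) (th_l am').
  + by rewrite fm gm => st pq; apply: mixed.
  + by rewrite fm gm => st pq; rewrite (th_sym medG) (th_sym medH) mixed.
  + by rewrite (th_r am) (th_r am').
move=> a b c d sq; case: (square_piece am sq) => -[x [y [z [w [Ea Eb Ec Ed]]]]].
  exists (f' x), (f' y), (f' z), (f' w); rewrite square_embed // -(square_embed _ _ _ _ fI fm).
  by rewrite -Ea -Eb -Ec -Ed; split=> //; left; [exists x, y | exists x, w].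
exists (g' x), (g' y), (g' z), (g' w); rewrite square_embed // -(square_embed _ _ _ _ gI gm).
by rewrite -Ea -Eb -Ec -Ed; split=> //; right; [exists x, y | exists x, w].
Qed.

Lemma edge_correspondence_ext (G H : sgraph) (R S : G -> G -> H -> H -> Prop) :
  (forall a b c d, R a b c d <-> S a b c d) -> edge_correspondence R -> edge_correspondence S.
Proof.
move=> RS [tot thR sq]; split.
- by move=> a b /tot[a' [b' [ab /RS]]]; exists a', b'.
- by move=> a b x y a' b' x' y' ab xy ab' xy' /RS r /RS s; apply: thR r s.
by move=> a b c d /sq[a' [b' [c' [d' [sq' /RS r /RS s]]]]]; exists a', b', c', d'.
Qed.

Lemma slides_Cross_iso (A B G H : sgraph)
    (f : A -> G) (g : B -> G) (f' : A -> H) (g' : B -> H) :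
  median_amalgam f g -> median_amalgam f' g' ->
  overlap_slides f g f' g' -> overlap_slides f' g' f g ->
  isomorphic (Cross G) (Cross H).
Proof.
move=> am am' sl sl'.
apply: (Cross_iso (amalgam_median am) (amalgam_median am')
          (piece_edges_correspondence am am' sl sl')).
apply: edge_correspondence_ext (piece_edges_correspondence am' am sl' sl) => a b c d.
by split=> -[] [x [y [-> -> -> ->]]]; [left | right | left | right]; exists x, y.
Qed.

(** * Slidings *)

Section SlidingAttachment.
Variables (A B : sgraph) (Y Y' : {set A}) (Z : {set B}) (phi : A -> B).
Hypotheses (medA : median A) (medB : median B).
Hypotheses (cvxY : convex Y) (cvxY' : convex Y') (cvxZ : convex Z).
Hypotheses (iso_phi : iso_on Y Z phi) (par : parallel Y Y').
Local Notation psi := (phi \o gate Y).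

(** Projecting between parallel subgraphs is an isomorphism. *)
Lemma iso_on_slide : iso_on Y' Z psi.
Proof.
have [inj_phi im_phi mono_phi] := iso_phi; have par' := parallel_sym par.
split.
- move=> x y xY yY /= /(inj_phi _ _ (gate_in medA x cvxY) (gate_in medA y cvxY)) E.
  by rewrite -(gateK medA cvxY cvxY' par xY) E (gateK medA cvxY cvxY' par yY).
- rewrite imset_comp -im_phi; have -> // : gate Y @: Y' = Y.
  apply/setP=> y; apply/imsetP/idP=> [[x _ ->]|yY]; first exact: gate_in.
  exists (gate Y' y); rewrite ?gate_in //.
  by rewrite (gateK medA cvxY' cvxY par' yY).
move=> x y xY yY /=; rewrite mono_phi ?gate_in //.
by apply/idP/idP=> /(adj_dist1 medA.1) E; apply/(adj_dist1 medA.1);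
  rewrite -E (gate_isometric medA cvxY cvxY' par).
Qed.

Section TwoAmalgams.
Variables (G H : sgraph) (f : A -> G) (g : B -> G) (f' : A -> H) (g' : B -> H).
Hypotheses (gl : glued_along Y phi f g) (gl' : glued_along Y' psi f' g').

Lemma slide_overlap_slides : overlap_slides f g f' g'.
Proof.
have par' := parallel_sym par.
move=> e1 e2 k1 k2 e12 /gl.2[e1Y ->] /gl.2[e2Y ->].
have D := gate_isometric medA cvxY' cvxY par' e1Y e2Y.
rewrite ((adj_dist1 medA.1 _ _).1 e12) in D.
exists (gate Y' e1), (gate Y' e2); split.
- by apply/gl'.2; rewrite gate_in //= (gateK medA cvxY' cvxY par').
- by apply/gl'.2; rewrite gate_in //= (gateK medA cvxY' cvxY par').
- exact/(adj_dist1 medA.1).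
by apply: gate_th => //; apply/eqP=> E; rewrite E distxx in D.
Qed.

Lemma slide_overlap_slides_back : overlap_slides f' g' f g.
Proof.
move=> e1 e2 k1 k2 e12 /gl'.2[e1Y ->] /gl'.2[e2Y ->].
have D := gate_isometric medA cvxY cvxY' par e1Y e2Y.
rewrite ((adj_dist1 medA.1 _ _).1 e12) in D.
exists (gate Y e1), (gate Y e2); split.
- by apply/gl.2; rewrite gate_in.
- by apply/gl.2; rewrite gate_in.
- exact/(adj_dist1 medA.1).
by apply: gate_th => //; apply/eqP=> E; rewrite E distxx in D.
Qed.

End TwoAmalgams.
End SlidingAttachment.

Lemma sliding_median M N : sliding M N -> median M /\ median N.
Proof.
case=> A [B [Y [Y' [Z [phi [[mA mB] [cY cZ cY'] iso_phi par [EM EN]]]]]]].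
have iso_psi := iso_on_slide mA cY cY' iso_phi par.
have /(isomorphic_amalgam _ iso_phi)[f [g gl]] := EM.
have /(isomorphic_amalgam _ iso_psi)[f' [g' gl']] := EN.
by split; [apply: amalgam_median (glued_median_amalgam mA mB cY cZ iso_phi gl) |
           apply: amalgam_median (glued_median_amalgam mA mB cY' cZ iso_psi gl')].
Qed.

Lemma sliding_Cross M N : sliding M N -> isomorphic (Cross M) (Cross N).
Proof.
case=> A [B [Y [Y' [Z [phi [[mA mB] [cY cZ cY'] iso_phi par [EM EN]]]]]]].
have iso_psi := iso_on_slide mA cY cY' iso_phi par.
have /(isomorphic_amalgam _ iso_phi)[f [g gl]] := EM.
have /(isomorphic_amalgam _ iso_psi)[f' [g' gl']] := EN.
apply: slides_Cross_iso (glued_median_amalgam mA mB cY cZ iso_phi gl)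
  (glued_median_amalgam mA mB cY' cZ iso_psi gl') _ _.
  exact: slide_overlap_slides gl gl'.
exact: slide_overlap_slides_back gl gl'.
Qed.

(** Sliding back uses the slid attaching map, because projecting to the parallel
    copy and back is the identity. *)
Lemma sliding_sym M N : sliding M N -> sliding N M.
Proof.
case=> A [B [Y [Y' [Z [phi [[mA mB] [cY cZ cY'] iso_phi par [EM EN]]]]]]].
have iso_psi := iso_on_slide mA cY cY' iso_phi par; have par' := parallel_sym par.
have iso_back := iso_on_slide mA cY' cY iso_psi par'.
exists A, B, Y', Y, Z, (phi \o gate Y); split=> //; split=> //.
have /(isomorphic_amalgam _ iso_phi)[f [g [am gl]]] := EM.
apply/(isomorphic_amalgam _ iso_back); exists f, g; split=> // x y.
rewrite gl; split=> -[xY ->]; split=> //=.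
all: by rewrite (gateK mA cY' cY par').
Qed.

Lemma sliding_iso M M' N N' :
  isomorphic M' M -> isomorphic N N' -> sliding M N -> sliding M' N'.
Proof.
move=> MM NN [A [B [Y [Y' [Z [phi [m c iso_phi par [EM EN]]]]]]]].
exists A, B, Y, Y', Z, phi; split=> //; split; first exact: isomorphic_trans MM EM.
exact: isomorphic_trans (isomorphic_sym NN) EN.
Qed.

Lemma slidings_iso M N N' : slidings M N -> isomorphic N N' -> slidings M N'.
Proof.
case=> [N0 MN|P N0 MP PN] NN; first by apply: Slidings0; apply: isomorphic_trans MN NN.
by apply: SlidingsS MP _; apply: sliding_iso (isomorphic_refl P) NN PN.
Qed.

Lemma slidings_trans M P N : slidings M P -> slidings P N -> slidings M N.
Proof.
move=> MP; elim=> {N} [N /(slidings_iso MP) //|Q N _ MQ QN]; exact: SlidingsS MQ QN.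
Qed.

Lemma slidings_sym M N : slidings M N -> slidings N M.
Proof.
elim=> {N} [N MN|P N _ PM PN]; first exact/Slidings0/isomorphic_sym.
apply: slidings_trans PM; apply: SlidingsS (sliding_sym PN).
exact: Slidings0 (isomorphic_refl N).
Qed.


(** * Subgraphs induced by convex sets *)

Section Induced.
Variables (G : sgraph) (S : {set G}).

Definition induced_adj (x y : {x : G | x \in S}) := adj (val x) (val y).

Lemma induced_adj_sym : symmetric induced_adj.
Proof. by move=> x y; rewrite /induced_adj adj_sym. Qed.

Lemma induced_adj_irrefl : irreflexive induced_adj.
Proof. by move=> x; rewrite /induced_adj adj_irrefl. Qed.

Definition induced : sgraph := SGraph induced_adj_sym induced_adj_irrefl.

Definition in_induced x (xS : x \in S) : induced := exist (fun x => x \in S) x xS.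

Definition inc (x : induced) : G := val x.

Lemma inc_in x : inc x \in S. Proof. exact: valP. Qed.

Lemma inc_inj : injective inc. Proof. exact: val_inj. Qed.

Definition trace (T : {set G}) : {set induced} := [set x | inc x \in T].

Lemma in_trace T x : (x \in trace T) = (inc x \in T). Proof. exact: in_set. Qed.

Hypotheses (medG : median G) (cvxS : convex S).
Let conn : connected G := medG.1.

Lemma induced_step n (x y : induced) :
  dist (inc x) (inc y) = n.+1 ->
  exists2 z : induced, adj x z & dist (inc z) (inc y) = n.
Proof.
move=> E; have [z xz zy] := dist_step conn E.
have zS : z \in S.
  apply: (convex_between medG cvxS (inc_in x) (inc_in y)); apply/betweenP.
  by rewrite E zy ((adj_dist1 conn _ _).1 xz).
by exists (in_induced zS).
Qed.

Lemma induced_connected : connected induced.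
Proof.
have [/set0Pn[x0 x0S] _] := cvxS; split.
  by apply/card_gt0P; exists (in_induced x0S).
move=> x y; move E: (dist (inc x) (inc y)) => n; elim: n x E => [|n IH] x E.
  by rewrite (inc_inj (dist_eq0 conn E)) connect0.
have [z xz /IH] := induced_step E; exact: connect_trans (connect1 xz).
Qed.

(** Geodesics between vertices of a convex set do not leave it. *)
Lemma induced_dist (x y : induced) : dist x y = dist (inc x) (inc y).
Proof.
have connS := induced_connected; apply/eqP; rewrite eqn_leq; apply/andP; split.
  move E: (dist (inc x) (inc y)) => n; elim: n x E => [|n IH] x E.
    by rewrite (inc_inj (dist_eq0 conn E)) distxx.
  have [z xz /IH zy] := induced_step E; apply: leq_trans (dist_triangle connS z x y) _.
  by rewrite ((adj_dist1 connS _ _).1 xz); lia.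
apply: (lipschitz_le_dist connS (F := fun z => dist (inc x) (inc z))); first exact: distxx.
move=> u v; rewrite -[adj u v]/(adj (inc u) (inc v)) => /(adj_dist1 conn) <-.
exact: dist_triangle.
Qed.

Lemma induced_median : median induced.
Proof.
split=> [|x y z]; first exact: induced_connected.
have [m [[m1 m2 m3] m_uniq]] := medG.2 (inc x) (inc y) (inc z).
have mS : m \in S by apply: (convex_between medG cvxS (inc_in x) (inc_in y)); apply/betweenP.
exists (in_induced mS); split=> [|n]; first by rewrite !induced_dist.
by rewrite !induced_dist => /m_uniq E; apply: inc_inj.
Qed.

Lemma trace_convex (T : {set G}) : convex T -> T \subset S -> convex (trace T).
Proof.
move=> cT sTS; apply/(between_convexP induced_connected); split.
  have [/set0Pn[x xT] _] := cT; apply/set0Pn; exists (in_induced (subsetP sTS x xT)).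
  by rewrite in_trace.
move=> x y z; rewrite !in_trace => xT yT /betweenP; rewrite !induced_dist => E.
by apply: (convex_between medG cT xT yT); apply/betweenP.
Qed.

Lemma induced_th (x y z w : induced) : th x y z w = th (inc x) (inc y) (inc z) (inc w).
Proof. by rewrite /th !induced_dist. Qed.

End Induced.

(** * The two boundaries of a wall *)

Definition halfspace (G : sgraph) (a b : G) : {set G} := [set x | side a b x].

Definition boundary (G : sgraph) (a b : G) : {set G} :=
  [set x | side a b x && [exists y, adj x y && side b a y]].

Section Boundary.
Variable G : sgraph.
Hypothesis medG : median G.
Implicit Types a b x y z u v : G.

Let conn : connected G := medG.1.
Let symd := dist_sym conn.
Let tri := dist_triangle conn.
Let adj1 := adj_dist1 conn.

Lemma boundaryP a b x :
  reflect (side a b x /\ exists y, adj x y /\ side b a y) (x \in boundary a b).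
Proof.
rewrite inE; apply: (iffP andP) => -[ax].
  by case/existsP=> y /andP[]; split=> //; exists y.
by case=> y [xy by_]; split=> //; apply/existsP; exists y; rewrite xy.
Qed.

Lemma boundary_sub a b : boundary a b \subset halfspace a b.
Proof. by apply/subsetP=> x; rewrite !inE => /andP[]. Qed.

Lemma boundary_match a b x y :
  adj x y -> side a b x -> side b a y -> x \in boundary a b /\ y \in boundary b a.
Proof.
move=> xy ax by_; split; apply/boundaryP; split=> //; first by exists y.
by exists x; rewrite adj_sym.
Qed.

Lemma boundary_l a b : adj a b -> a \in boundary a b.
Proof.
by move=> ab; apply/boundaryP; rewrite side_l //; split=> //; exists b; rewrite side_l // adj_sym.
Qed.

Lemma halfspace_convex a b : adj a b -> convex (halfspace a b).
Proof.
move=> ab; apply/(between_convexP conn); split.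
  by apply/set0Pn; exists a; rewrite inE side_l.
by move=> x y z; rewrite !inE; apply: side_convex.
Qed.

(** Every crossing edge cuts out the same two halfspaces as the defining one. *)
Lemma matched_dist a b x y z :
  adj a b -> adj x y -> side a b x -> side b a y -> side a b z ->
  dist z y = dist z x + 1.
Proof.
by move=> ab xy ax bny; rewrite (side_eq medG ab xy ax bny) => /side_dist; apply.
Qed.

(** The median of z, u and v is at distance one from z, and lies between u and v,
    on their side of the wall. *)
Lemma boundary_criterion a b z u v :
  adj a b -> side b a z -> side a b u -> side a b v ->
  dist z u + dist z v = dist u v + 2 -> z \in boundary b a.
Proof.
move=> ab bz au av E; have [m [E1 E2 E3]] := medianE medG z u v.
apply/boundaryP; split=> //; exists m; split.
  by apply/adj1; have := symd u m; lia.
by apply: (side_convex medG ab au av); apply/betweenP.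
Qed.

Lemma boundary_between a b x y z :
  adj a b -> x \in boundary b a -> y \in boundary b a -> side b a z ->
  between x z y -> z \in boundary b a.
Proof.
move=> ab /boundaryP[bx [u [xu au]]] /boundaryP[by_ [v [yv av]]] bz /betweenP E.
have ba : adj b a by rewrite adj_sym.
apply: (boundary_criterion ab bz au av).
rewrite (matched_dist ba xu bx au bz) (matched_dist ba yv by_ av bz).
by rewrite (matching_isometric medG ba xu yv bx au by_ av) E (symd x z); lia.
Qed.

Lemma boundary_convex a b : adj a b -> convex (boundary a b).
Proof.
move=> ab; have ba : adj b a by rewrite adj_sym.
apply/(between_convexP conn); split; first by apply/set0Pn; exists a; apply: boundary_l.
move=> x y z xB yB xzy; apply: (boundary_between ba xB yB) => //.
by have /boundaryP[ax _] := xB; have /boundaryP[ay _] := yB; apply: (side_convex medG ab ax ay xzy).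
Qed.

Lemma extended_halfspace_convex a b : adj a b -> convex (halfspace a b :|: boundary b a).
Proof.
move=> ab; have ba : adj b a by rewrite adj_sym.
have mixed x y z : side a b x -> y \in boundary b a -> side b a z -> between x z y ->
    z \in boundary b a.
  move=> ax /boundaryP[by_ [v [yv av]]] bz /betweenP E.
  apply: (boundary_criterion ab bz ax av); rewrite adj_sym in yv.
  have := matched_dist ab yv av by_ ax; rewrite adj_sym in yv.
  by have := matched_dist ba yv by_ av bz; rewrite E (symd x z); lia.
apply/(between_convexP conn); split.
  by apply/set0Pn; exists a; rewrite inE inE side_l.
move=> x y z; rewrite !in_setU ![_ \in halfspace _ _]inE => xA yA xzy.
case az: (side a b z) => //=; have bz : side b a z by rewrite sideC // az.
case/orP: xA => [ax|xB]; case/orP: yA => [ay|yB].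
- by move: az; rewrite (side_convex medG ab ax ay xzy).
- exact: mixed ax yB bz xzy.
- apply: (mixed y x) => //; move/betweenP: xzy => E; apply/betweenP.
  by rewrite (symd y x) (symd y z) (symd z x); lia.
exact: boundary_between ab xB yB bz xzy.
Qed.

Lemma matched_edge_th a b x y u v :
  adj a b -> adj x y -> adj x u -> adj y v ->
  side a b x -> side a b y -> side b a u -> side b a v -> adj u v /\ th x y u v.
Proof.
move=> ab xy xu yv ax ay bu bv.
have uv : dist u v = 1.
  by rewrite (matching_isometric medG ab xu yv ax bu ay bv); apply/adj1.
split; first exact/adj1.
rewrite /th (matched_dist ab xu ax bu ay) (matched_dist ab yv ay bv ax).
by move: (symd x y) => s; rewrite (adj1 _ _).1 // (adj1 y v).1 // -s (adj1 x y).1.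
Qed.

End Boundary.


(** * Folding a median graph towards a base vertex *)

(** The quantity that folding decreases. *)
Definition total_dist (G : sgraph) (o : G) := \sum_(x : G) dist o x.

Lemma sum_amalgam (A B G : sgraph) (f : A -> G) (g : B -> G) (F : G -> nat) :
  amalgamated f g ->
  \sum_(u : G) F u = \sum_(x : A) F (f x) + \sum_(y in ~: overlap g f) F (g y).
Proof.
move=> [[fI gI] _ cov _]; rewrite (bigID [in f @: setT]) /=; congr (_ + _).
  rewrite (big_imset _ (in2W fI)) /=; by apply: eq_bigl => x; rewrite inE.
rewrite -(big_imset _ (in2W gI)) /=; apply: eq_bigl => u.
apply/idP/imsetP=> [/imsetP nfu|[y]].
  case: (cov u) => -[x E]; first by case: nfu; exists x.
  exists x => //; rewrite inE; apply/overlapP=> -[y Ey]; case: nfu.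
  by exists y => //; rewrite E.
by rewrite inE => /overlapP no ->; apply/imsetP=> -[x _ E]; case: no; exists x.
Qed.

Section Fold.
Variables (M : sgraph) (o b : M).
Hypotheses (medM : median M) (ob : adj o b).
Let bo : adj b o. Proof. by rewrite adj_sym. Qed.
Let conn : connected M := medM.1.

Local Notation near := (halfspace o b :|: boundary b o).
Local Notation far := (halfspace b o).
Local Notation A := (induced near).
Local Notation B := (induced far).

Let cvxN : convex near := extended_halfspace_convex medM ob.
Let cvxF : convex far := halfspace_convex medM bo.
Let medA : median A := induced_median medM cvxN.
Let medB : median B := induced_median medM cvxF.

Local Notation Y := (trace near (boundary b o)).
Local Notation Y' := (trace near (boundary o b)).
Local Notation Z := (trace far (boundary b o)).

Let bF : b \in far. Proof. by rewrite inE (side_l medM). Qed.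
Let bN : b \in near. Proof. by rewrite in_setU (boundary_l medM) ?orbT. Qed.
Let oN : o \in near. Proof. by rewrite in_setU inE (side_l medM). Qed.

(** The attaching map is the identity; its value outside the boundary is a
    default. *)
Let phi (x : A) : B := insubd (in_induced bF) (inc x).

Let phiK x : inc x \in far -> inc (phi x) = inc x.
Proof. exact: insubdK. Qed.

Let boundary_far x : x \in boundary b o -> x \in far.
Proof. exact/subsetP/boundary_sub. Qed.

Let cvxY : convex Y.
Proof. by apply: trace_convex (boundary_convex medM bo) (subsetUr _ _). Qed.

Let cvxY' : convex Y'.
Proof.
apply: trace_convex (boundary_convex medM ob) _ => //.
by rewrite (subset_trans (boundary_sub o b)) ?subsetUl.
Qed.

Let cvxZ : convex Z.
Proof. exact: trace_convex (boundary_convex medM bo) (boundary_sub b o). Qed.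

Let iso_phi : iso_on Y Z phi.
Proof.
have phiY x : x \in Y -> inc (phi x) = inc x by rewrite in_trace => /boundary_far/phiK.
split=> [x y xY yY E||x y xY yY].
- by apply: inc_inj; rewrite -(phiY x) // E phiY.
- apply/setP=> y; apply/imsetP/idP=> [[x xY ->]|yZ].
    by rewrite in_trace phiY //; rewrite in_trace in xY.
  have yN : inc y \in near by rewrite in_setU; rewrite in_trace in yZ; rewrite yZ orbT.
  have yY : in_induced yN \in Y by rewrite in_trace; rewrite in_trace in yZ.
  by exists (in_induced yN) => //; apply: inc_inj; rewrite phiY.
by rewrite -[LHS]/(adj (inc (phi x)) (inc (phi y))) !phiY.
Qed.

Let par : parallel Y Y'.
Proof.
have matched (c d x y : M) : adj c d -> adj x y -> x \in boundary c d -> y \in boundary c d ->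
    exists u v, [/\ adj u v, u \in boundary d c, v \in boundary d c & th x y u v].
  move=> cd xy /boundaryP[cx [u [xu du]]] /boundaryP[cy [v [yv dv]]].
  have [uv T] := matched_edge_th medM cd xy xu yv cx cy du dv.
  by exists u, v; rewrite (boundary_match xu cx du).2 (boundary_match yv cy dv).2.
have bN1 x : x \in boundary b o -> x \in near by rewrite in_setU orbC => ->.
have bN2 x : x \in boundary o b -> x \in near.
  by rewrite in_setU => /(subsetP (boundary_sub _ _)) ->.
apply/(parallelP medA); split=> x y xy; rewrite !in_trace => xY yY.
  have [u [v [uv uB vB T]]] := matched _ _ _ _ bo xy xY yY.
  exists (in_induced (bN2 _ uB)), (in_induced (bN2 _ vB)).
  by rewrite !in_trace (induced_th medM cvxN).
have [u [v [uv uB vB T]]] := matched _ _ _ _ ob xy xY yY.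
exists (in_induced (bN1 _ uB)), (in_induced (bN1 _ vB)).
by rewrite !in_trace (induced_th medM cvxN).
Qed.

Let gate_o : gate Y (in_induced oN) = in_induced bN.
Proof.
apply: gate_uniq => //; first by rewrite in_trace (boundary_l medM).
move=> y; rewrite in_trace => /boundary_far; rewrite inE => by_; apply/betweenP.
rewrite !(induced_dist medM cvxN) /=; rewrite -[inc (in_induced oN)]/o -[inc (in_induced bN)]/b.
rewrite ((adj_dist1 conn _ _).1 ob) (dist_sym conn o) (dist_sym conn b).
by rewrite (side_dist medM bo by_) addnC.
Qed.

Let glued_M : glued_along Y phi (@inc M near) (@inc M far).
Proof.
have farN x : (x \in far) = (x \notin halfspace o b) by rewrite !inE sideC.
split; last first.
  move=> x y; rewrite in_trace; split=> [E|[xY ->]]; last by rewrite phiK // boundary_far.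
  have xF : inc x \in far by rewrite E inc_in.
  have := inc_in x; rewrite in_setU; move: (xF); rewrite farN => /negbTE -> /= xB.
  by split=> //; apply: inc_inj; rewrite phiK.
split; [by split; exact: inc_inj | by [] | move=> u | move=> u v uv].
  case uF : (u \in far); first by right; exists (in_induced uF).
  have uN : u \in near by rewrite in_setU; move: uF; rewrite farN => /negbFE ->.
  by left; exists (in_induced uN).
case uF : (u \in far); case vF : (v \in far).
- by right; exists (in_induced uF), (in_induced vF).
- have vH : v \in halfspace o b by move: vF; rewrite farN => /negbFE.
  have [_ uB] : v \in boundary o b /\ u \in boundary b o.
    by apply: boundary_match; rewrite 1?adj_sym //; [move: vH | move: uF]; rewrite inE.
  have uN : u \in near by rewrite in_setU uB orbT.
  have vN : v \in near by rewrite in_setU vH.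
  by left; exists (in_induced uN), (in_induced vN).
- have uH : u \in halfspace o b by move: uF; rewrite farN => /negbFE.
  have [_ vB] : u \in boundary o b /\ v \in boundary b o.
    by apply: boundary_match => //; [move: uH | move: vF]; rewrite inE.
  have uN : u \in near by rewrite in_setU uH.
  have vN : v \in near by rewrite in_setU vB orbT.
  by left; exists (in_induced uN), (in_induced vN).
have uN : u \in near by rewrite in_setU; move: uF; rewrite farN => /negbFE ->.
have vN : v \in near by rewrite in_setU; move: vF; rewrite farN => /negbFE ->.
by left; exists (in_induced uN), (in_induced vN).
Qed.

(** Sliding the far halfspace from its own boundary to the opposite one brings
    every vertex of the far halfspace outside its boundary one step closer to
    the base vertex, and moves no other vertex. *)
Lemma fold (z : M) :
  side b o z -> z \notin boundary b o ->
  exists (N : sgraph) (o' : N), sliding M N /\ total_dist o' < total_dist o.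
Proof.
move=> bz nz; have iso_psi := iso_on_slide medA cvxY cvxY' iso_phi par.
have [f [g gl]] := amalgam_pieces iso_psi.
have amM := glued_median_amalgam medA medB cvxY cvxZ iso_phi glued_M.
have amN := glued_median_amalgam medA medB cvxY' cvxZ iso_psi gl.
exists (amalgam Y' (phi \o gate Y)), (f (in_induced oN)); split.
  exists A, B, Y, Y', Z, phi; split=> //; split; last exact: isomorphic_refl.
  by apply/(isomorphic_amalgam _ iso_phi); exists (@inc M near), (@inc M far).
have Ef : f (in_induced oN) = g (in_induced bF).
  apply/gl.2; rewrite in_trace (boundary_l medM) //=; split=> //.
  by rewrite gate_o; apply: inc_inj; rewrite phiK.
have [_ _ amM' _ _] := amM; have [_ _ amN' _ _] := amN.
rewrite /total_dist (sum_amalgam _ amM') (sum_amalgam _ amN').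
rewrite (glued_overlap glued_M).2 (glued_overlap gl).2.
have [_ -> _] := iso_phi; have [_ -> _] := iso_psi.
have -> : \sum_(x : A) dist (f (in_induced oN)) (f x) = \sum_(x : A) dist o (inc x).
  by apply: eq_bigr => x _; rewrite (amalgam_isometric_l amN) (induced_dist medM cvxN).
rewrite ltn_add2l.
have -> : \sum_(y in ~: Z) dist o (inc y) = \sum_(y in ~: Z) (dist b (inc y) + 1).
  apply: eq_bigr => y _; have := inc_in y; rewrite inE => /(side_dist medM bo).
  by rewrite (dist_sym conn o) (dist_sym conn b).
have -> : \sum_(y in ~: Z) dist (f (in_induced oN)) (g y) = \sum_(y in ~: Z) dist b (inc y).
  by apply: eq_bigr => y _; rewrite Ef (amalgam_isometric_r amN) (induced_dist medM cvxF).
rewrite big_split /= sum1_card -[X in X < _]addn0 ltn_add2l; apply/card_gt0P.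
have zF : z \in far by rewrite inE.
by exists (in_induced zF); rewrite in_setC in_trace.
Qed.

End Fold.

(** Every wall at o is peripheral on its far side: folding along it would not
    shorten any distance to o. *)
Definition folded (M : sgraph) (o : M) :=
  forall b, adj o b -> halfspace b o \subset boundary b o.

Lemma slide_to_folded (M : sgraph) :
  median M -> exists (N : sgraph) (o : N), [/\ median N, folded o & slidings M N].
Proof.
move=> medM; have /card_gt0P[o _] := medM.1.1.
move: {2}(total_dist o).+1 (ltnSn (total_dist o)) => n.
elim: n M medM o => // n IH M medM o le_n.
case fold_o: [forall b, adj o b ==> (halfspace b o \subset boundary b o)].
  exists M, o; split=> //; last exact: Slidings0 (isomorphic_refl M).
  by move=> b; move/forallP/(_ b)/implyP: fold_o.
move/negbT: fold_o => /forallPn[b]; rewrite negb_imply => /andP[ob /subsetPn[z]].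
rewrite inE => bz nz; have [N [o' [MN lt_o']]] := fold medM ob bz nz.
have [_ medN] := sliding_median MN.
have [K [k [medK fK NK]]] := IH N medN o' (leq_trans lt_o' le_n).
exists K, k; split=> //; apply: slidings_trans NK.
by apply: SlidingsS MN; exact: Slidings0 (isomorphic_refl M).
Qed.


(** * Simplex graphs *)

Section SimplexGraph.
Variable K : sgraph.

Definition clique (S : {set K}) := [forall x in S, forall y in S, (x != y) ==> adj x y].

Lemma cliqueP (S : {set K}) :
  reflect (forall x y, x \in S -> y \in S -> x != y -> adj x y) (clique S).
Proof.
apply: (iffP forall_inP) => [H x y xS yS xy|H x xS].
  by move/forall_inP: (H x xS) => /(_ y yS)/implyP; apply.
by apply/forall_inP=> y yS; apply/implyP; apply: H.
Qed.

Definition simplex_adj (S T : {S : {set K} | clique S}) :=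
  [exists v, ((v \notin val S) && (val T == v |: val S)) ||
             ((v \notin val T) && (val S == v |: val T))].

Lemma simplex_adj_sym : symmetric simplex_adj.
Proof. by move=> S T; apply: eq_existsb => v; rewrite orbC. Qed.

Lemma simplex_adj_irrefl : irreflexive simplex_adj.
Proof.
move=> S; apply/negbTE/existsPn=> v; rewrite orbb; apply/andP=> -[vS /eqP E].
by move: vS; rewrite E setU11.
Qed.

(** The empty clique is a vertex; it corresponds to the base vertex of a folded
    graph. *)
Definition simplex_graph : sgraph := SGraph simplex_adj_sym simplex_adj_irrefl.

End SimplexGraph.

(** * Folded median graphs are simplex graphs *)

Section Folded.
Variables (M : sgraph) (o : M).
Hypotheses (medM : median M) (foldM : folded o).
Implicit Types b x y : M.

Let conn : connected M := medM.1.
Let symd := dist_sym conn.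
Let tri := dist_triangle conn.
Let adj1 := adj_dist1 conn.

Lemma folded_match b x :
  adj o b -> side b o x ->
  exists x', [/\ adj x x', side o b x' & dist o x = dist o x' + 1].
Proof.
move=> ob bx; have bo : adj b o by rewrite adj_sym.
have /(subsetP (foldM ob))/boundaryP[_ [x' [xx' ox']]] : x \in halfspace b o by rewrite inE.
exists x'; split=> //; have := matching_dist medM bo xx' bx ox'.
by have := side_dist medM bo bx; have := symd o x; have := symd o x'; lia.
Qed.

(** Matching across the walls at the base vertex moves an edge towards the base
    vertex within its class. *)
Lemma folded_edge x y : adj x y -> exists b, adj o b /\ th o b x y.
Proof.
(* Edges of a bipartite graph can be oriented away from o. *)
have sorted n u v : adj u v -> dist o u = n -> dist o v = n + 1 -> exists b, adj o b /\ th o b u v.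
  elim: n u v => [|n IH] u v uv du dv.
    by exists v; rewrite {1 2}(dist_eq0 conn du) uv -(dist_eq0 conn du) th_refl // (dist_eq0 conn du).
  have [c oc cu] := dist_step conn du; have co : adj c o by rewrite adj_sym.
  have dcv := tri c o v; have cv1 := tri u c v; have oc1 := (adj1 _ _).1 oc; have uv1 := (adj1 _ _).1 uv.
  have sym_cu := symd c u; have sym_ou := symd o u; have sym_cv := symd c v; have sym_ov := symd o v.
  have scu : side c o u by rewrite /side; lia.
  have scv : side c o v by rewrite /side; lia.
  have [u' [uu' ou' du']] := folded_match oc scu.
  have [v' [vv' ov' dv']] := folded_match oc scv.
  have [uv' T] := matched_edge_th medM co uv uu' vv' scu scv ou' ov'.
  have [b [ob T']] : exists b, adj o b /\ th o b u' v'.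
    by apply: (IH _ _ uv'); [move: du' du | move: dv' dv]; clear; lia.
  exists b; split=> //; apply: (th_trans medM ob uv' uv T').
  by rewrite (th_sym medM).
move=> xy; have xy1 := (adj1 _ _).1 xy.
have := median_bipartite medM o xy; have := tri x o y; have := tri y o x.
rewrite (symd y x) xy1 => le1 le2 neq.
case: (leqP (dist o x) (dist o y)) => le.
  by apply: (sorted (dist o x)); lia.
have [|||b [ob T]] := sorted (dist o y) y x; rewrite 1?adj_sym //; first lia.
by exists b; rewrite th_swapr in T.
Qed.

Lemma base_edge_uniq b b' : adj o b -> adj o b' -> th o b o b' -> b = b'.
Proof.
move=> ob ob'; rewrite th_side // side_l //= => nob'.
apply: (matching_uniq medM ob ob ob'); rewrite ?side_l //; first by rewrite adj_sym.
by rewrite sideC //; move: nob'; case: (side o b b').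
Qed.

Lemma base_edge_uniq_th b b' x y :
  adj o b -> adj o b' -> adj x y -> th o b x y -> th o b' x y -> b = b'.
Proof.
move=> ob ob' xy T T'; apply: base_edge_uniq => //; apply: (th_trans medM ob xy ob' T).
by rewrite (th_sym medM).
Qed.

Lemma other_sides b b' x y :
  adj o b -> adj o b' -> adj x y -> th o b x y -> b != b' -> side b' o x = side b' o y.
Proof.
move=> ob ob' xy T /eqP neq; rewrite !(sideC medM _ ob').
case: (boolP (th o b' x y)) => [/(base_edge_uniq_th ob ob' xy T) //|].
by rewrite th_side // negbK => /eqP ->.
Qed.

(** The corner opposite o is the median of b, b' and x. *)
Lemma base_square b b' x :
  adj o b -> adj o b' -> b != b' -> side b o x -> side b' o x ->
  exists m, square o b m b'.
Proof.
move=> ob ob' neq bx bx'; have bo : adj b o by rewrite adj_sym.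
have bo' : adj b' o by rewrite adj_sym.
have D := side_dist medM bo bx; have D' := side_dist medM bo' bx'.
have [m [m1 m2 m3]] := medianE medM b b' x.
have o1 := (adj1 _ _).1 bo; have o2 := (adj1 _ _).1 ob'; have le2 := tri o b b'.
have nbb' : dist b b' != 1.
  by apply/eqP=> /adj1 /(median_bipartite medM o); rewrite o2 ((adj1 _ _).1 ob).
have nbb0 : dist b b' != 0 by apply: contraNneq neq => /(dist_eq0 conn) ->.
have sbx := symd b x; have sbx' := symd b' x; have sm := symd m b'; have so := symd o x.
have bm : dist b m = 1 by lia.
have mb' : dist m b' = 1 by lia.
have tom := tri m o x.
exists m; rewrite /square ob bo' neq (adj1 b m).2 // (adj1 m b').2 //=.
apply/and3P; split.
- by apply/eqP=> E; move: m2 D sbx so; rewrite -E; clear; lia.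
- by apply/negP=> /adj1; move: tom m2 bm D sbx so; clear; lia.
by apply/negP=> /adj1 E; rewrite E in nbb'.
Qed.

(** Four corners of a square lie in the four intersections of the halfspaces of
    its two classes. *)
Lemma square_quadrant b b' p q r s :
  adj o b -> adj o b' -> b != b' -> square p q r s -> th o b p q -> th o b' p s ->
  exists t, side b o t /\ side b' o t.
Proof.
move=> ob ob' neq /and5P[pq qr rs sp /and4P[pr qs npr nqs]] T T'.
have ps : adj p s by rewrite adj_sym.
have dist2 x y z : adj x y -> adj y z -> x != z -> ~~ adj x z -> dist x z = 2.
  move=> /adj1 xy /adj1 yz xz nxz; have := tri y x z; rewrite xy yz.
  case E: (dist x z) => [|[|[|]]] // _; first by rewrite (dist_eq0 conn E) eqxx in xz.
  by rewrite (adj1 _ _).2 in nxz.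
have dpr := dist2 _ _ _ pq qr pr npr; have dqs := dist2 _ _ _ qr rs qs nqs.
have Tsr : th p q s r.
  by rewrite /th dpr ((adj1 _ _).1 ps) ((adj1 _ _).1 qr) dqs.
have Tqr : th p s q r.
  by rewrite /th dpr ((adj1 _ _).1 pq) (symd s r) (symd s q) ((adj1 _ _).1 rs) dqs.
have sr : adj s r by rewrite adj_sym.
have Sb := other_sides ob' ob ps T'; have Sb' := other_sides ob ob' pq T neq.
rewrite eq_sym in neq; have {}Sb : side o b p = side o b s by apply/negb_inj; rewrite -!(sideC medM _ ob) Sb.
have {}Sb' : side o b' p = side o b' q by apply/negb_inj; rewrite -!(sideC medM _ ob') Sb'.
have := th_trans medM ob pq sr T Tsr; have := th_trans medM ob' ps qr T' Tqr.
move: T T'; rewrite !(th_side medM) // => Tb Tb' Tr' Tr.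
have qr1 t : ~~ side o b t -> ~~ side o b' t -> exists t, side b o t /\ side b' o t.
  by move=> nb nb'; exists t; rewrite (sideC medM _ ob) (sideC medM _ ob').
have some_corner (p1 q1 r1 s1 p2 q2 r2 s2 : bool) :
    p1 = s1 -> p2 = q2 -> p1 != q1 -> p2 != s2 -> q2 != r2 -> s1 != r1 ->
    [|| ~~ p1 && ~~ p2, ~~ q1 && ~~ q2, ~~ r1 && ~~ r2 | ~~ s1 && ~~ s2].
  by move=> -> ->; case: s1; case: q2; case: q1; case: s2; case: r2; case: r1.
by case/or4P: (some_corner _ _ _ _ _ _ _ _ Sb Sb' Tb Tb' Tr' Tr) => /andP[]; exact: qr1.
Qed.

(** Induction on the distance from o. Let c be a neighbour of o on the way to x:
    the vertex x' matched to x across the wall oc has, by induction, a neighbour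
    y' beyond the wall ob, and the median of x, y' and a vertex beyond both walls
    completes the square on x, x', y'. *)
Lemma folded_extend b x :
  adj o b -> side o b x ->
  (forall b', adj o b' -> side b' o x -> exists t, side b o t /\ side b' o t) ->
  exists y, adj x y /\ side b o y.
Proof.
move=> ob; have bo : adj b o by rewrite adj_sym.
move E: (dist o x) => n; elim: n x E => [|n IH] x E obx quad.
  by exists b; rewrite -(dist_eq0 conn E) ob side_l.
have [c oc cx] := dist_step conn E; have co : adj c o by rewrite adj_sym.
have scx : side c o x by rewrite /side (symd x c) (symd x o) cx E.
have [x' [xx' ox' dx']] := folded_match oc scx.
have x1 := (adj1 _ _).1 xx'.
have bet : between o x' x.
  by apply/betweenP; move: dx' x1 (symd x x'); clear; lia.
have obx' : side o b x'.
  by apply: (side_convex medM ob _ obx bet); rewrite side_l.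
have [||y' [xy' by']] := IH x' _ obx'; first by move: dx' E; clear; lia.
  move=> b' ob' bx'; apply: quad => //; rewrite sideC //; apply: contraL bx' => obx1.
  rewrite (sideC medM _ ob') negbK.
  by apply: (side_convex medM ob' _ obx1 bet); rewrite side_l.
have [q [bq cq]] := quad c oc scx.
have [m [m1 m2 m3]] := medianE medM x y' q.
have cm : side c o m by apply: (side_convex medM co scx cq); apply/betweenP.
have bm : side b o m by apply: (side_convex medM bo by' bq); apply/betweenP.
exists m; split=> //.
have y1 := (adj1 _ _).1 xy'; have le2 := tri x' x y'.
have neqxm : dist x m != 0.
  by apply: contraTneq bm => /(dist_eq0 conn) <-; rewrite sideC // obx.
have neqmy : dist m y' != 0.
  apply: contraTneq cm => /(dist_eq0 conn) ->; rewrite sideC // negbK.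
  have neq : b != c by apply: contraTneq scx => <-; rewrite sideC // obx.
  rewrite -[side o c y']negbK -(sideC medM _ oc) -(other_sides ob oc xy') //.
    by rewrite (sideC medM _ oc) negbK ox'.
  by rewrite th_side // obx' -(sideC medM _ ob) by'.
by apply/adj1; move: m1 le2 neqxm neqmy x1 y1; clear; lia.
Qed.

(** * The isomorphism with the simplex graph *)

Section SimplexIso.
Variables (K : sgraph) (kappa : K -> Cross M).
Hypothesis kappa_iso : graph_iso kappa.

(** Foldedness moves every class down to the base vertex, where distinct edges
    belong to distinct walls; so vertices of K can be replaced by neighbours of
    o. *)
Lemma base_neighbours :
  exists nb : K -> M, [/\ forall k, adj o (nb k) /\ val (kappa k) = class_of [set o; nb k],
    injective nb & forall b, adj o b -> exists k, nb k = b].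
Proof.
have [[h kh hk] _] := kappa_iso.
have [nb nbP] : exists nb : K -> M, forall k,
    adj o (nb k) /\ val (kappa k) = class_of [set o; nb k].
  apply: (@fin_all_exists K (fun=> M)
    (fun k b => adj o b /\ val (kappa k) = class_of [set o; b])) => k.
  have /theta_classesP[x [y [xy ->]]] := valP (kappa k).
  have [b [ob T]] := folded_edge xy; exists b; split=> //; apply/eqP.
  by rewrite (class_of_eq medM xy ob) (th_sym medM).
exists nb; split=> // [k l E|b ob].
  apply: (can_inj kh); apply: val_inj.
  by have [_ ->] := nbP k; have [_ ->] := nbP l; rewrite E.
exists (h (exist (fun C => C \in theta_classes M) _ (class_of_in ob))).
set k := h _; have [onb E] := nbP k; apply: base_edge_uniq => //.
by rewrite -(class_of_eq medM) // -E /k hk.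
Qed.

(** The isomorphism sends x to the set sigma x of the classes that separate x
    from o. Crossing an edge changes sigma in one class only, and towards any
    y != x there is an edge whose class separates x from y: this gives
    injectivity and adjacency. *)
Lemma folded_simplex : isomorphic M (simplex_graph K).
Proof.
have [nb [nbP nbI nb_surj]] := base_neighbours.
have onb k : adj o (nb k) by case: (nbP k).
have nb_val k : val (kappa k) = class_of [set o; nb k] by case: (nbP k).
have [_ kappa_adj] := kappa_iso.
pose sigma x : {set K} := [set k | side (nb k) o x].
have in_sigma k x : (k \in sigma x) = side (nb k) o x by rewrite in_set.
have wall k x : (k \in sigma x) = ~~ side o (nb k) x by rewrite in_sigma (sideC medM).
have edge_class x y : adj x y -> exists k, th o (nb k) x y.
  by move=> /folded_edge[b [/nb_surj[k <-] T]]; exists k.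
have sigma_adj k x y : adj x y -> th o (nb k) x y ->
    (k \in sigma x) != (k \in sigma y) /\
    forall l, l != k -> (l \in sigma x) = (l \in sigma y).
  move=> xy T; split=> [|l lk].
    by move: T; rewrite th_side // !wall; case: (side _ _ x); case: (side _ _ y).
  rewrite !in_sigma; apply: (other_sides (onb k)) => //.
  by apply: contraNneq lk => /nbI ->.
have sigma_clique x : clique (sigma x).
  apply/cliqueP=> k l; rewrite !in_sigma => sk sl kl.
  have neq : nb k != nb l by apply: contraNneq kl => /nbI ->.
  have [m sq] := base_square (onb k) (onb l) neq sk sl.
  rewrite -kappa_adj; apply/andP; split.
    by rewrite val_eqE; apply: contraNneq kl => E; apply/eqP; case: kappa_iso => -[h kh _] _;
       apply: (can_inj kh).
  apply/existsP; exists o; apply/existsP; exists (nb k); apply/existsP; exists m.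
  by apply/existsP; exists (nb l); rewrite sq !nb_val !in_class_of // !th_refl.
have toward x y : x != y -> exists z k, [/\ adj x z, dist x y = dist z y + 1,
    th o (nb k) x z & (k \in sigma z) = (k \in sigma y)].
  move=> neq; case E: (dist x y) => [|n]; first by rewrite (dist_eq0 conn E) eqxx in neq.
  have [z xz zy] := dist_step conn E; have [k T] := edge_class _ _ xz.
  exists z, k; split=> //; first by rewrite zy addn1.
  rewrite !wall; have zx : adj z x by rewrite adj_sym.
  have syz : side z x y by rewrite /side (symd y z) (symd y x) zy E.
  have szz : side z x z by rewrite side_l.
  have [Es|Es] := th_same_side medM (onb k) xz T; rewrite !Es; last by rewrite szz syz.
  by rewrite -!(sideC medM _ xz) szz syz.
have sigma_inj : injective sigma.
  move=> x y E; apply/eqP; apply/negPn/negP=> /toward[z [k [xz _ T Ez]]].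
  by have [+ _] := sigma_adj k x z xz T; rewrite Ez E eqxx.
have sigma_surj (S : {set K}) : clique S -> exists x, sigma x = S.
  move E: #|S| => n; elim: n S E => [|n IH] S E cS.
    exists o; move/eqP: E; rewrite cards_eq0 => /eqP ->; apply/setP=> k.
    by rewrite in_sigma in_set0 side_r.
  have /card_gt0P[k kS] : 0 < #|S| by rewrite E.
  have [||x Ex] := IH (S :\ k).
  - by move: E; rewrite (cardsD1 k) kS => -[].
  - by apply/cliqueP=> i j; rewrite !inE => /andP[_ iS] /andP[_ jS]; move/cliqueP: cS; apply.
  have kx : k \notin sigma x by rewrite Ex !inE eqxx.
  have [||y [xy ky]] := folded_extend (onb k) (x := x).
  - by move: kx; rewrite wall negbK.
  - move=> b' /nb_surj[l <-]; rewrite -in_sigma Ex !inE => /andP[lk lS].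
    have : adj k l by move/cliqueP: cS; apply; rewrite // eq_sym.
    rewrite -kappa_adj => /andP[_ /existsP[p /existsP[q /existsP[r /existsP[s]]]]].
    case/and3P=> sq; have /and5P[pq _ _ sp _] := sq; rewrite adj_sym in sp.
    rewrite !nb_val !in_class_of // => T T'.
    by apply: square_quadrant sq T T' => //; apply: contraNneq lk => /nbI ->.
  exists y; apply/setP=> l; case: (eqVneq l k) => [->|lk]; first by rewrite in_sigma ky kS.
  have T : th o (nb k) x y by move: kx ky; rewrite th_side // wall negbK (sideC medM _ (onb k)) => ->.
  by have [_ <-] := sigma_adj k x y xy T; rewrite // Ex !inE lk.
exists (fun x => exist (fun S => clique S) (sigma x) (sigma_clique x)); split.
  have [g gP] : exists g : simplex_graph K -> M, forall S, sigma (g S) = val S.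
    by apply: (@fin_all_exists (simplex_graph K) (fun=> M)
      (fun S x => sigma x = val S)) => S; apply: sigma_surj (valP S).
  exists g => [x|S]; first by apply: sigma_inj; rewrite gP.
  by apply: val_inj; rewrite /= gP.
move=> x y; apply/idP/idP=> [|xy]; last first.
  have [k T] := edge_class _ _ xy; have [nk eqs] := sigma_adj k x y xy T.
  apply/existsP; exists k => /=; move: nk.
  case kx: (k \in sigma x); case ky: (k \in sigma y) => // _; rewrite ?orbF /=.
    apply/eqP/setP=> l; rewrite in_setU1; case: (eqVneq l k) => [->|lk] //=.
    by rewrite (eqs l lk).
  apply/eqP/setP=> l; rewrite in_setU1; case: (eqVneq l k) => [->|lk] //=.
  by rewrite (eqs l lk).
(* The first edge from u towards v can only be of class k, and then its end has
   the same image as v. *)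
have half u v k : k \notin sigma u -> sigma v = k |: sigma u -> adj u v.
  move=> ku E; have neq : u != v by apply: contraNneq ku => ->; rewrite E setU11.
  have [z [l [uz _ T Ez]]] := toward _ _ neq; have [nl eqs] := sigma_adj l u z uz T.
  have lk : l = k.
    by apply/eqP/negPn/negP=> lk; move: nl; rewrite Ez E in_setU1 (negbTE lk) eqxx.
  rewrite -(sigma_inj z v) //; apply/setP=> i; case: (eqVneq i l) => [->|il] //.
  by rewrite -(eqs i il) E in_setU1 -lk (negbTE il).
case/existsP=> k /orP[]/andP[kx /eqP E]; first exact: half kx E.
by rewrite adj_sym; exact: half kx E.
Qed.

End SimplexIso.
End Folded.


(** * Slidings and crossing graphs *)

Lemma graph_iso_dist_le (G H : sgraph) (f : G -> H) x y :
  connected G -> connected H -> {mono f : u v / adj u v} -> dist (f x) (f y) <= dist x y.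
Proof.
move=> connG connH f_adj; apply: (lipschitz_le_dist connG (F := fun z => dist (f x) (f z))).
  exact: distxx.
move=> u v; rewrite -f_adj => /(adj_dist1 connH) <-; exact: dist_triangle.
Qed.

Lemma isomorphic_Cross (G H : sgraph) :
  median G -> median H -> isomorphic G H -> isomorphic (Cross G) (Cross H).
Proof.
move=> medG medH [f [[h fh hf] f_adj]].
have h_adj : {mono h : u v / adj u v} by move=> u v; rewrite -f_adj !hf.
have f_dist x y : dist (f x) (f y) = dist x y.
  apply/eqP; rewrite eqn_leq (graph_iso_dist_le _ _ medG.1 medH.1 f_adj).
  by rewrite -{1}(fh x) -{1}(fh y) (graph_iso_dist_le _ _ medH.1 medG.1 h_adj).
have f_th a b x y : th (f a) (f b) (f x) (f y) = th a b x y by rewrite /th !f_dist.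
have f_sq := fun a b c d => square_embed a b c d (can_inj fh) f_adj.
apply: (@Cross_iso G H (fun a b a' b' => a' = f a /\ b' = f b)) => //; split.
- by move=> a b ab; exists (f a), (f b); rewrite f_adj.
- by move=> a b x y a' b' x' y' _ _ _ _ [-> ->] [-> ->]; rewrite f_th.
- by move=> a b c d sq; exists (f a), (f b), (f c), (f d); rewrite f_sq.
- by move=> a b ab; exists (h a), (h b); rewrite h_adj !hf.
- by move=> a b x y a' b' x' y' _ _ _ _ [-> ->] [-> ->]; rewrite f_th.
by move=> a b c d sq; exists (h a), (h b), (h c), (h d); rewrite -f_sq !hf.
Qed.

Lemma slidings_Cross (M N : sgraph) :
  median M -> median N -> slidings M N -> isomorphic (Cross M) (Cross N).
Proof.
move=> medM medN MN; elim: MN medN => {N} [N MN medN|P N _ IH PN _].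
  exact: isomorphic_Cross.
have [medP _] := sliding_median PN.
exact: isomorphic_trans (IH medP) (sliding_Cross PN).
Qed.

Theorem theorem1p2 (M N : sgraph) (hM : median M) (hN : median N) :
  isomorphic (Cross M) (Cross N) <-> slidings M N.
Proof.
split=> [MN|]; last exact: slidings_Cross.
have [M' [m [medM' fold_m MM']]] := slide_to_folded hM.
have [N' [n [medN' fold_n NN']]] := slide_to_folded hN.
have [kappa kappa_iso] : isomorphic (Cross M') (Cross N').
  apply: isomorphic_trans (isomorphic_sym (slidings_Cross hM medM' MM')) _.
  exact: isomorphic_trans MN (slidings_Cross hN medN' NN').
have id_iso : graph_iso (@id (Cross M')) by split=> //; exists id.
have MN' : isomorphic M' N'.
  apply: isomorphic_trans (folded_simplex medM' fold_m id_iso) _.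
  exact: isomorphic_sym (folded_simplex medN' fold_n kappa_iso).
exact: slidings_trans (slidings_iso MM' MN') (slidings_sym NN').
Qed.
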